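(* Consider the compound MAC model with arbitrarily correlated sources $(S_1,S_2)$ and receiver side information $(W_1,W_2)$. Let $U=f(S_1)=g(S_2)$ be the Gács–Körner common part of $S_1,S_2$. Source-channel rate $b=1$ is achievable if there is a joint distribution $$p(q,s_1,s_2,w_1,w_2,x_1,x_2,y_1,y_2)=p(q)p(s_1,s_2,w_1,w_2)p(x_1|q,s_1)p(x_2|q,s_2)p(y_1,y_2|x_1,x_2)$$ such that for both $k=1,2$: $$H(S_1|S_2,W_k)<I(X_1;Y_k|X_2,S_2,W_k,Q),\quad H(S_2|S_1,W_k)<I(X_2;Y_k|X_1,S_1,W_k,Q),$$ $$H(S_1,S_2|U,W_k)<I(X_1,X_2;Y_k|U,W_k,Q),\quad H(S_1,S_2|W_k)<I(X_1,X_2;Y_k|W_k).$$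
   Context: Compound MAC model: $\{(S_{1,k},S_{2,k},W_{1,k},W_{2,k})\}_{k\ge1}$ i.i.d. $\sim p(s_1,s_2,w_1,w_2)$ on finite alphabets. Transmitter $i\in\{1,2\}$ observes $S_i^m$ and sends $X_i^n=f_i^{(m,n)}(S_i^m)$. The channel $p(y_1,y_2|x_1,x_2)$ is discrete memoryless with finite alphabets. Receiver $k\in\{1,2\}$ observes $(Y_k^n,W_k^m)$ and outputs $(\hat S_{k,1}^m,\hat S_{k,2}^m)=g_k^{(m,n)}(Y_k^n,W_k^m)$, an estimate of both sources. Error probability $P_e^{(m,n)}=\Pr\{\bigcup_{k=1,2}\{(S_1^m,S_2^m)\neq(\hat S_{k,1}^m,\hat S_{k,2}^m)\}\}$. Rate $b$ is achievable if for every $\epsilon>0$ there exist positive integers $m,n$ with $n/m=b$ and encoders/decoders with $P_e^{(m,n)}<\epsilon$. The Gács–Körner common part is the maximal-entropy random variable $U$ with $U=f(S_1)=g(S_2)$ almost surely. *)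

(* Defs.v *)
From Stdlib Require Import Reals.
From mathcomp Require Import all_boot.
Set Implicit Arguments. Unset Strict Implicit. Unset Printing Implicit Defensive.

Local Open Scope R_scope.

Definition rsum (T : finType) (F : T -> R) : R := \big[Rplus/0]_(x : T) F x.

Definition is_pmf (T : finType) (p : T -> R) : Prop :=
  (forall x, 0 <= p x) /\ rsum p = 1.

Definition prob (O : finType) (P : O -> R) (E : pred O) : R :=
  \big[Rplus/0]_(o : O | E o) P o.

(* conditional entropy H(X|Y) (natural log) of random variables X, Y defined on (O,P):
   H(X|Y) = - sum_o P(o) ln( P(X = X o, Y = Y o) / P(Y = Y o) ).
   Outcomes with P o = 0 contribute 0. *)
Definition cond_entropy (O : finType) (P : O -> R) (A B : eqType)
    (X : O -> A) (Y : O -> B) : R :=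
  - rsum (fun o => P o *
      ln (prob P (fun o' => (X o' == X o) && (Y o' == Y o))
          / prob P (fun o' => Y o' == Y o))).

Definition entropy (O : finType) (P : O -> R) (A : eqType) (X : O -> A) : R :=
  cond_entropy P X (fun _ => tt).

Definition cond_mutinfo (O : finType) (P : O -> R) (A B C : eqType)
    (X : O -> A) (Y : O -> B) (Z : O -> C) : R :=
  cond_entropy P X Z - cond_entropy P X (fun o => (Y o, Z o)).

Definition mutinfo (O : finType) (P : O -> R) (A B : eqType)
    (X : O -> A) (Y : O -> B) : R :=
  cond_mutinfo P X Y (fun _ => tt).

Section Model.
Variables (S1 S2 W1 W2 X1 X2 Y1 Y2 : finType).

Definition src := (S1 * S2 * W1 * W2)%type.

Definition common_fun (pS : src -> R) (TU : finType) (fU : S1 -> TU) (gU : S2 -> TU) : Prop :=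
  forall s1 s2 w1 w2, 0 < pS (s1, s2, w1, w2) -> fU s1 = gU s2.

Definition is_GK_common (pS : src -> R) (TU : finType) (fU : S1 -> TU) (gU : S2 -> TU) : Prop :=
  common_fun pS fU gU /\
  forall (T : finType) (f' : S1 -> T) (g' : S2 -> T),
    common_fun pS f' g' ->
    entropy pS (fun o : src => f' o.1.1.1) <= entropy pS (fun o : src => fU o.1.1.1).

Definition error_prob (pS : src -> R) (W : X1 -> X2 -> (Y1 * Y2)%type -> R)
    (m n : nat)
    (f1 : {ffun 'I_m -> S1} -> {ffun 'I_n -> X1})
    (f2 : {ffun 'I_m -> S2} -> {ffun 'I_n -> X2})
    (g1 : {ffun 'I_n -> Y1} * {ffun 'I_m -> W1} -> {ffun 'I_m -> S1} * {ffun 'I_m -> S2})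
    (g2 : {ffun 'I_n -> Y2} * {ffun 'I_m -> W2} -> {ffun 'I_m -> S1} * {ffun 'I_m -> S2}) : R :=
  \big[Rplus/0]_(s : {ffun 'I_m -> src})
    let s1 := [ffun i => (s i).1.1.1] in
    let s2 := [ffun i => (s i).1.1.2] in
    let w1 := [ffun i => (s i).1.2] in
    let w2 := [ffun i => (s i).2] in
    let x1 := f1 s1 in
    let x2 := f2 s2 in
    (\big[Rmult/1]_(i < m) pS (s i)) *
    \big[Rplus/0]_(y : {ffun 'I_n -> (Y1 * Y2)%type} |
                     (g1 ([ffun j => (y j).1], w1) != (s1, s2))
                  || (g2 ([ffun j => (y j).2], w2) != (s1, s2)))
       \big[Rmult/1]_(j < n) W (x1 j) (x2 j) (y j).

Definition achievable (pS : src -> R) (W : X1 -> X2 -> (Y1 * Y2)%type -> R) (b : R) : Prop :=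
  forall eps, 0 < eps ->
    exists m n : nat, (0 < m)%N /\ (0 < n)%N /\ INR n / INR m = b /\
      exists f1 f2 g1 g2, error_prob pS W (m:=m) (n:=n) f1 f2 g1 g2 < eps.

Definition omega (Q : finType) := (Q * src * X1 * X2 * (Y1 * Y2))%type.

Definition joint (Q : finType) (pQ : Q -> R) (pS : src -> R)
    (p1 : Q -> S1 -> X1 -> R) (p2 : Q -> S2 -> X2 -> R)
    (W : X1 -> X2 -> (Y1 * Y2)%type -> R) (o : omega Q) : R :=
  let '(q, s, x1, x2, y) := o in
  pQ q * pS s * p1 q s.1.1.1 x1 * p2 q s.1.1.2 x2 * W x1 x2 y.

Definition rvQ Q (o : omega Q) : Q := o.1.1.1.1.
Definition rvS1 Q (o : omega Q) : S1 := o.1.1.1.2.1.1.1.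
Definition rvS2 Q (o : omega Q) : S2 := o.1.1.1.2.1.1.2.
Definition rvW1 Q (o : omega Q) : W1 := o.1.1.1.2.1.2.
Definition rvW2 Q (o : omega Q) : W2 := o.1.1.1.2.2.
Definition rvX1 Q (o : omega Q) : X1 := o.1.1.2.
Definition rvX2 Q (o : omega Q) : X2 := o.1.2.
Definition rvY1 Q (o : omega Q) : Y1 := o.2.1.
Definition rvY2 Q (o : omega Q) : Y2 := o.2.2.

End Model.

Definition receiver_conds (O : finType) (P : O -> R) (Q S1 S2 U Wk X1 X2 Yk : eqType)
    (q : O -> Q) (s1 : O -> S1) (s2 : O -> S2) (u : O -> U) (w : O -> Wk)
    (x1 : O -> X1) (x2 : O -> X2) (y : O -> Yk) : Prop :=
  [/\ cond_entropy P s1 (fun o => (s2 o, w o))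
        < cond_mutinfo P x1 y (fun o => (x2 o, s2 o, w o, q o)),
      cond_entropy P s2 (fun o => (s1 o, w o))
        < cond_mutinfo P x2 y (fun o => (x1 o, s1 o, w o, q o)),
      cond_entropy P (fun o => (s1 o, s2 o)) (fun o => (u o, w o))
        < cond_mutinfo P (fun o => (x1 o, x2 o)) y (fun o => (u o, w o, q o))
    & cond_entropy P (fun o => (s1 o, s2 o)) w
        < cond_mutinfo P (fun o => (x1 o, x2 o)) y w].

(* Main.v *)
(* Random coding with superposition on the common part.  Blocks of length n are sent with
   m = n.  A cloud centre q^n(u^n) is drawn from p(q)^n for every u^n, then independent
   codewords x_i^n(s_i^n) from p(x_i|q,s_i)^n, where q^n is the centre of f(s_1^n), resp.
   of g(s_2^n).  Each receiver looks for the only (s_1,s_2) with f(s_1) = g(s_2) that passes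
   four likelihood ratio tests P(z,k) >= L kappa(z|k) P(k), one for each way in which a
   wrong pair can differ from the true one: only s_1 differs, only s_2 differs, both differ
   but u agrees, u differs.  Here k is what the wrong pair shares with the truth (including
   the channel output) and kappa is the law of the independently drawn rest z.  Changing
   measure from kappa(z|k) P(k) to P(z,k), the expected number of wrong pairs that pass a
   test is at most 1/L.  The expectation of ln P(z,k)/(kappa(z|k) P(k)) is exactly the
   difference of the two sides of the corresponding entropy condition, hence positive, so
   with L = exp(n delta) the true pair fails a test with exponentially small probability
   (Chernoff). *)

From HB Require Import structures.
Require Import Defs.
From Stdlib Require Import Reals Lra Classical FunctionalExtensionality.
From mathcomp Require Import all_boot.

Set Implicit Arguments.
Unset Strict Implicit.

Local Open Scope R_scope.

(** * Big operators over the reals, expectations and probabilities on finite types *)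

HB.instance Definition _ := Monoid.isComLaw.Build R 0 Rplus
  (fun x y z => esym (Rplus_assoc x y z)) Rplus_comm Rplus_0_l.
HB.instance Definition _ := Monoid.isComLaw.Build R 1 Rmult
  (fun x y z => esym (Rmult_assoc x y z)) Rmult_comm Rmult_1_l.
HB.instance Definition _ := Monoid.isMulLaw.Build R 0 Rmult Rmult_0_l Rmult_0_r.
HB.instance Definition _ := Monoid.isAddLaw.Build R Rmult Rplus
  Rmult_plus_distr_r Rmult_plus_distr_l.

Definition expect (T : finType) (p F : T -> R) : R :=
  \big[Rplus/0]_(x : T) (p x * F x).

Definition indic (b : bool) : R := if b then 1 else 0.

Definition Rleb (x y : R) : bool := if Rle_dec x y then true else false.

Lemma RlebP (x y : R) : reflect (x <= y) (Rleb x y).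
Proof. by rewrite /Rleb; case: Rle_dec => h; constructor. Qed.

Arguments Rleb : simpl never.

Section Sums.
Variable T : finType.
Implicit Types (p F G : T -> R) (E : pred T).

Lemma sum_le (I : Type) (r : seq I) (P : pred I) (F G : I -> R) :
  (forall i, P i -> F i <= G i) ->
  \big[Rplus/0]_(i <- r | P i) F i <= \big[Rplus/0]_(i <- r | P i) G i.
Proof.
move=> h; elim/big_rec2: _ => [|i x y Pi xy]; first by apply: Rle_refl.
by apply: Rplus_le_compat; first exact: h.
Qed.

Lemma sum_ge0 (I : Type) (r : seq I) (P : pred I) (F : I -> R) :
  (forall i, P i -> 0 <= F i) -> 0 <= \big[Rplus/0]_(i <- r | P i) F i.
Proof.
move=> h; elim/big_rec: _ => [|i x Pi x0]; first by apply: Rle_refl.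
by have := h i Pi; lra.
Qed.

Lemma prod_ge0 (I : Type) (r : seq I) (P : pred I) (F : I -> R) :
  (forall i, P i -> 0 <= F i) -> 0 <= \big[Rmult/1]_(i <- r | P i) F i.
Proof.
move=> h; elim/big_rec: _ => [|i x Pi x0]; first by lra.
by apply: Rmult_le_pos; first exact: h.
Qed.

Lemma indic_ge0 b : 0 <= indic b. Proof. by case: b => /=; lra. Qed.

Lemma indicU b c : indic (b || c) <= indic b + indic c.
Proof. by case: b; case: c => /=; lra. Qed.

Lemma expectE p F : expect p F = \big[Rplus/0]_(x : T) (p x * F x).
Proof. by []. Qed.

Lemma eq_expect_supp p F G : (forall x, 0 <= p x) ->
  (forall x, 0 < p x -> F x = G x) -> expect p F = expect p G.
Proof.
move=> p0 h; apply: eq_bigr => x _.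
have [lt|<-] := Rle_lt_or_eq_dec _ _ (p0 x); first by rewrite h.
by rewrite !Rmult_0_l.
Qed.

Lemma eq_expect p F G : (forall x, F x = G x) -> expect p F = expect p G.
Proof. by move=> h; apply: eq_bigr => x _; rewrite h. Qed.

Lemma expect_le p F G : (forall x, 0 <= p x) ->
  (forall x, 0 < p x -> F x <= G x) -> expect p F <= expect p G.
Proof.
move=> p0 h; apply: sum_le => x _.
have [lt|<-] := Rle_lt_or_eq_dec _ _ (p0 x); last by rewrite !Rmult_0_l; lra.
by apply: Rmult_le_compat_l; [lra|exact: h].
Qed.

Lemma expect_ge0 p F : (forall x, 0 <= p x) -> (forall x, 0 <= F x) ->
  0 <= expect p F.
Proof. by move=> p0 F0; apply: sum_ge0 => x _; apply: Rmult_le_pos. Qed.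

Lemma expectD p F G : expect p (fun x => F x + G x) = expect p F + expect p G.
Proof. by rewrite -big_split; apply: eq_bigr => x _ /=; lra. Qed.

Lemma expectZl p c F : expect p (fun x => c * F x) = c * expect p F.
Proof. by rewrite /expect big_distrr; apply: eq_bigr => x _ /=; lra. Qed.

Lemma expect_cst p c : rsum p = 1 -> expect p (fun=> c) = c.
Proof. by move=> h; rewrite /expect -big_distrl /= -/(rsum p) h; lra. Qed.

Lemma expect_sum p (I : Type) (r : seq I) (P : pred I) (F : I -> T -> R) :
  expect p (fun x => \big[Rplus/0]_(i <- r | P i) F i x) =
  \big[Rplus/0]_(i <- r | P i) expect p (F i).
Proof.
rewrite exchange_big /=; apply: eq_bigr => x _.
by rewrite big_distrr.
Qed.

Lemma probE p E : prob p E = expect p (fun x => indic (E x)).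
Proof.
rewrite /prob big_mkcond; apply: eq_bigr => x _.
by case: (E x) => /=; lra.
Qed.

Lemma eq_prob p E E' : E =1 E' -> prob p E = prob p E'.
Proof. by move=> h; apply: eq_bigl. Qed.

Lemma prob_ge0 p E : (forall x, 0 <= p x) -> 0 <= prob p E.
Proof. by move=> p0; apply: sum_ge0. Qed.

Lemma prob_gt0 p E x : (forall x, 0 <= p x) -> 0 < p x -> E x -> 0 < prob p E.
Proof.
move=> p0 px Ex; rewrite /prob (bigD1 x) //=.
by apply: Rplus_lt_le_0_compat => //; apply: sum_ge0.
Qed.

(** Averaging argument that later extracts one deterministic code from the random ensemble. *)
Lemma expect_lt_ex p F e : is_pmf p -> expect p F < e -> exists x, F x < e.
Proof.
case=> p0 p1 lt; have [[x ltx]|] := classic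
  (exists x, F x < e); first by exists x.
move=> h; suff: e <= expect p F by lra.
rewrite -[X in X <= _](@expect_cst p) //; apply: expect_le => // x _.
by apply: Rnot_lt_le => ltx; apply: h; exists x.
Qed.

End Sums.

Lemma expect_swap (A B : finType) (p : A -> R) (q : B -> R) (F : A -> B -> R) :
  expect p (fun a => expect q (F a)) = expect q (fun b => expect p (F^~ b)).
Proof. by rewrite expect_sum; apply: eq_bigr => b _; rewrite expectZl. Qed.

(** * Extension of a law by a kernel *)

Definition ext (A B : finType) (M : A -> R) (k : A -> B -> R) (o : A * B) : R :=
  M o.1 * k o.1 o.2.

Section Extension.
Variables (A B : finType) (M : A -> R) (k : A -> B -> R).

Lemma expect_ext F :
  expect (ext M k) F = expect M (fun a => expect (k a) (fun b => F (a, b))).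
Proof.
rewrite /expect; under [RHS]eq_bigr do rewrite big_distrr /=.
by rewrite pair_bigA; apply: eq_bigr => -[a b] _; rewrite /ext /=; lra.
Qed.

Lemma ext_pmf : is_pmf M -> (forall a, is_pmf (k a)) -> is_pmf (ext M k).
Proof.
move=> [M0 M1] hk; split=> [[a b]|].
  by apply: Rmult_le_pos => //; case: (hk a).
rewrite -M1 /rsum /ext /= -(pair_bigA _ (fun a b => M a * k a b)) /=.
apply: eq_bigr => a _; rewrite -big_distrr /=.
by case: (hk a) => _; rewrite /rsum => ->; lra.
Qed.

(** On [E] the kernel gives [F] the same mass [c], which comes out as a factor. The marginals of the
    joint law are computed this way, one kernel at a time. *)
Lemma prob_ext (E : pred A) (F : pred B) c :
  (forall a, E a -> prob (k a) F = c) ->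
  prob (ext M k) (fun o => E o.1 && F o.2) = prob M E * c.
Proof.
move=> h; rewrite !probE expect_ext [RHS]Rmult_comm -expectZl.
apply: eq_expect => a /=; case Ea: (E a) => /=.
  by rewrite -probE h //; lra.
by rewrite /expect big1 => [|b _]; lra.
Qed.

Lemma prob_ext1 (E : pred A) : (forall a, rsum (k a) = 1) ->
  prob (ext M k) (fun o => E o.1) = prob M E.
Proof.
move=> h; rewrite -[RHS]Rmult_1_r -(@prob_ext E predT) => [|a _].
  by apply: eq_bigl => o; rewrite /= andbT.
by rewrite -(h a).
Qed.

End Extension.

Lemma prob_pred1 (T : finType) (p : T -> R) x : prob p (fun y => y == x) = p x.
Proof. by rewrite /prob big_pred1_eq. Qed.

Lemma prob_partition (Om A : finType) (P : Om -> R) (E : pred Om) (X : Om -> A) :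
  \big[Rplus/0]_(x : A) prob P (fun o => (X o == x) && E o) = prob P E.
Proof.
rewrite /prob (partition_big X predT) //=; apply: eq_bigr => x _.
by apply: eq_bigl => o; rewrite andbC.
Qed.

(** * Likelihood ratio tests *)

Section Test.
Variables (Om ZT KT : finType) (P : Om -> R) (Z : Om -> ZT) (K : Om -> KT).
Variables (kap : ZT -> KT -> R).

(** Multiplied out, so that candidates for which [kap] or the law of [K] vanishes cause no division
    by zero. *)
Definition passes (L : R) (z : ZT) (k : KT) : bool :=
  Rleb (L * kap z k * prob P (fun o => K o == k))
       (prob P (fun o => (Z o == z) && (K o == k))).

Definition density (o : Om) : R :=
  prob P (fun o' => (Z o' == Z o) && (K o' == K o)) /
    (kap (Z o) (K o) * prob P (fun o' => K o' == K o)).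

(** The first clause keeps [ln] away from its default value 0 at nonpositive arguments, and excludes
    zero denominators on the support, where the quotient would be 0. *)
Definition informative : Prop :=
  (forall o, 0 < P o -> 0 < density o) /\ 0 < expect P (fun o => ln (density o)).

(** Grouped by the value [k] of [K], every passing [z] has [L] times its weight at most the joint
    probability of [z] and [k], and these probabilities sum to 1. [kap] is a weight rather than a
    normalised law: later it counts source words. *)
Lemma expect_passes L : is_pmf P -> 0 < L ->
  expect P (fun o => \big[Rplus/0]_(z : ZT)
     (kap z (K o) * indic (passes L z (K o)))) <= / L.
Proof.
move=> [P0 P1] L0.
apply: (Rmult_le_reg_l L) => //; rewrite Rinv_r; last by lra.
have -> : expect P (fun o => \big[Rplus/0]_(z : ZT)
     (kap z (K o) * indic (passes L z (K o)))) =
   \big[Rplus/0]_(k : KT) (prob P (fun o => K o == k) * \big[Rplus/0]_(z : ZT)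
     (kap z k * indic (passes L z k))).
  rewrite /expect (partition_big K predT) //=; apply: eq_bigr => k _.
  by rewrite /prob big_distrl /=; apply: eq_bigr => o /eqP ->.
rewrite -P1 /rsum -/(prob P predT) -(prob_partition P predT K).
rewrite big_distrr /=; apply: sum_le => k _.
under [X in _ <= X]eq_bigl do rewrite andbT.
rewrite -/(prob P (fun o => K o == k)) -[X in _ <= X](prob_partition P _ Z).
rewrite !big_distrr /=; apply: sum_le => z _.
rewrite /passes; case: RlebP => h /=; first by lra.
by rewrite !Rmult_0_r; apply: prob_ge0.
Qed.

End Test.
Arguments passes : simpl never.

(** * Product measures and the Chernoff bound *)

(** Independent coordinates whose laws may vary. The index type is a set of source or common words
    for codebooks, and ['I_n] for blocks. *)
Definition prodm (A B : finType) (mu : A -> B -> R) (h : {ffun A -> B}) : R :=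
  \big[Rmult/1]_(a : A) mu a (h a).

Section Product.
Variables (A B : finType) (mu : A -> B -> R).

Lemma expect_prodm (F : A -> B -> R) :
  expect (prodm mu) (fun h => \big[Rmult/1]_(a : A) F a (h a)) =
  \big[Rmult/1]_(a : A) expect (mu a) (F a).
Proof. by rewrite bigA_distr_bigA /=; apply: eq_bigr => h _; rewrite -big_split. Qed.

Hypothesis mu_pmf : forall a, is_pmf (mu a).

Lemma prodm_pmf : is_pmf (prodm mu).
Proof.
split=> [h|]; first by apply: prod_ge0 => a _; case: (mu_pmf a).
rewrite /rsum /prodm -(bigA_distr_bigA (fun a b => mu a b)) /=.
by apply: big1 => a _; case: (mu_pmf a).
Qed.

Lemma expand_point (T : finType) (F : T -> R) x :
  F x = \big[Rplus/0]_(y : T) (F y * indic (x == y)).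
Proof.
rewrite (bigD1 x) //= eqxx big1 => [|y yx] /=; first by lra.
by rewrite eq_sym (negbTE yx) /=; lra.
Qed.

(** Expanded over point masses, [F (h a)] is a combination of products over all coordinates in which
    only the factor at [a] differs from 1. *)
Lemma expect_prodm1 a (F : B -> R) :
  expect (prodm mu) (fun h => F (h a)) = expect (mu a) F.
Proof.
rewrite [RHS]expectE; under eq_expect do rewrite (expand_point F).
rewrite expect_sum; apply: eq_bigr => b _.
rewrite expectZl Rmult_comm; congr (_ * _).
pose G c d := if c == a then indic (d == b) else 1.
rewrite (@eq_expect _ _ _ (fun h : {ffun A -> B} => \big[Rmult/1]_c G c (h c))); last first.
  by move=> h; rewrite (bigD1 a) //= big1 => [|c /negbTE ca]; rewrite /G ?eqxx ?ca //; lra.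
rewrite expect_prodm (bigD1 a) //= big1 => [|c /negbTE ca].
  by rewrite /G eqxx -[RHS](prob_pred1 (mu a)) probE /= Rmult_1_r.
by rewrite /G ca expect_cst //; case: (mu_pmf c).
Qed.

(** Independence of distinct coordinates is what makes the codeword of a wrong candidate a fresh
    draw. *)
Lemma expect_prodm2 a a' (F : B -> B -> R) : a != a' ->
  expect (prodm mu) (fun h => F (h a) (h a')) =
  expect (mu a) (fun b => expect (mu a') (F b)).
Proof.
move=> aa'; have a'a : a' != a by rewrite eq_sym.
rewrite [RHS]expectE.
under eq_expect => h.
  rewrite (expand_point (fun b => F b (h a'))).
  under eq_bigr => b _ do rewrite (expand_point (F b)).
  over.
rewrite expect_sum; apply: eq_bigr => b _.
under eq_expect do rewrite Rmult_comm big_distrr /=.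
rewrite (expectE (mu a')) big_distrr expect_sum; apply: eq_bigr => b' _ /=.
pose G c d := if c == a then indic (d == b)
  else if c == a' then indic (d == b') else 1.
rewrite (@eq_expect _ _ _ (fun h : {ffun A -> B} => F b b' * \big[Rmult/1]_c G c (h c))); last first.
  move=> h; rewrite (bigD1 a) //= (bigD1 a') //= big1.
    by rewrite /G eqxx (negbTE a'a) eqxx; lra.
  by move=> c /andP[/negbTE ca /negbTE ca']; rewrite /G ca ca'.
rewrite expectZl expect_prodm (bigD1 a) //= (bigD1 a') //= big1.
  rewrite /G eqxx (negbTE a'a) eqxx -!probE !prob_pred1 /=; lra.
move=> c /andP[/negbTE ca /negbTE ca'].
by rewrite /G ca ca' expect_cst //; case: (mu_pmf c).
Qed.

End Product.

Lemma indic_forall (A : finType) (E : pred A) :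
  indic [forall a, E a] = \big[Rmult/1]_(a : A) indic (E a).
Proof.
case: (boolP [forall a, E a]) => [/forallP h|].
  by rewrite big1 // => a _; rewrite h.
by move=> /forallPn[a /negbTE Ea]; rewrite (bigD1 a) //= Ea /=; lra.
Qed.

Lemma prob_prodm (A B : finType) (mu : A -> B -> R) (E : A -> pred B) :
  prob (prodm mu) (fun h => [forall a, E a (h a)]) =
  \big[Rmult/1]_(a : A) prob (mu a) (E a).
Proof.
rewrite probE (@eq_expect _ _ _ _ (fun h : {ffun A -> B} => indic_forall (fun a => E a (h a)))).
rewrite (expect_prodm _ (fun a b => indic (E a b))).
by apply: eq_bigr => a _; rewrite probE.
Qed.

Lemma prod_exp (I : Type) (r : seq I) (P : pred I) (F : I -> R) :
  \big[Rmult/1]_(i <- r | P i) exp (F i) = exp (\big[Rplus/0]_(i <- r | P i) F i).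
Proof. by apply/esym/big_morph; [exact: exp_plus|exact: exp_0]. Qed.

Lemma prod_cst n c : \big[Rmult/1]_(i < n) c = c ^ n.
Proof. by elim: n => [|n IH]; rewrite ?big_ord0 // big_ord_recl IH. Qed.

Lemma sum_cst n c : \big[Rplus/0]_(i < n) c = INR n * c.
Proof.
elim: n => [|n IH]; first by rewrite big_ord0 /=; lra.
by rewrite big_ord_recl IH S_INR; lra.
Qed.

Lemma prodm_gt0 (A B : finType) (mu : A -> B -> R) h :
  (forall a b, 0 <= mu a b) -> 0 < prodm mu h -> forall a, 0 < mu a (h a).
Proof.
move=> mu0 + a; rewrite /prodm (bigD1 a) //=.
by have [//|<-] := Rle_lt_or_eq_dec _ _ (mu0 a (h a)); lra.
Qed.

(** Since [exp (- x) >= 1 - x], it suffices that [(1 - x) * (1 + x + 2 * x ^ 2)], which equals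
    [1 + x ^ 2 * (1 - 2 * x)], is at least 1. *)
Lemma exp_le_quadratic x : Rabs x <= 1 / 2 -> exp x <= 1 + x + 2 * x ^ 2.
Proof.
move=> hx; have [h1 h2] : - (1 / 2) <= x <= 1 / 2 by split_Rabs; lra.
have e1 : exp (- x) * exp x = 1 by rewrite -exp_plus Rplus_opp_l exp_0.
have e2 := exp_ineq1_le (- x); have e3 := exp_pos x.
apply: (Rmult_le_reg_l (exp (- x))); first exact: exp_pos.
rewrite e1; have : 1 <= (1 - x) * (1 + x + 2 * x ^ 2) by nra.
by move=> h; apply: (Rle_trans _ _ _ h); apply: Rmult_le_compat_r; nra.
Qed.

(** The logarithms are bounded on a finite type, so a small negative exponential moment is below 1.
    Markov's inequality turns it into geometric decay, while [L] grows exponentially. *)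
Lemma chernoff (Om : finType) (P r : Om -> R) : is_pmf P ->
  (forall o, 0 < P o -> 0 < r o) -> 0 < expect P (fun o => ln (r o)) ->
  forall eps, 0 < eps -> exists N : nat, forall n, (N <= n)%N ->
  exists2 L, 0 < L &
    prob (prodm (fun _ : 'I_n => P))
      (fun h => ~~ Rleb L (\big[Rmult/1]_(i < n) r (h i))) + / L < eps.
Proof.
move=> Ppmf r0 m0 eps eps0; have [P0 P1] := Ppmf.
(* [d] is the growth rate of the threshold; half of the mean [m] leaves [z] with the positive mean
   [m / 2]. *)
set m := expect P _ in m0; pose d := m / 2; pose z o := ln (r o) - d.
pose M := 1 + \big[Rplus/0]_o Rabs (z o).
have zM o : Rabs (z o) <= M.
  rewrite /M (bigD1 o) //=; set S := \big[Rplus/0]_(i | _) _.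
  have : 0 <= S by apply: sum_ge0 => i _; exact: Rabs_pos.
  lra.
have M1 : 1 <= M.
  rewrite /M; have : 0 <= \big[Rplus/0]_o Rabs (z o)
    by apply: sum_ge0 => i _; exact: Rabs_pos.
  lra.
(* The bound [t * M <= 1 / 2] admits the quadratic estimate of [exp (- t * z o)]. The other bound
   keeps the quadratic term below [t * m / 4], half of the linear gain [t * m / 2]. *)
have [t [t0 tM tm]] : exists t, [/\ 0 < t, t * M <= 1 / 2 & t * (8 * M ^ 2) <= m].
  have hM : 0 < 8 * M ^ 2 by nra.
  exists (Rmin (/ (2 * M)) (m / (8 * M ^ 2))); split.
  - apply: Rmin_glb_lt; first by apply: Rinv_0_lt_compat; lra.
    exact: Rdiv_lt_0_compat.
  - apply: (Rle_trans _ (/ (2 * M) * M)).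
      by apply: Rmult_le_compat_r; [lra|exact: Rmin_l].
    by right; field; lra.
  - apply: (Rle_trans _ (m / (8 * M ^ 2) * (8 * M ^ 2))).
      by apply: Rmult_le_compat_r; [lra|exact: Rmin_r].
    by right; field; lra.
pose phi o := exp (- t * z o); pose th := expect P phi.
have th0 : 0 <= th by apply: expect_ge0 => // o; left; exact: exp_pos.
have th1 : th < 1.
  have : th <= expect P (fun o => (1 + 2 * (t * M) ^ 2 + t * d) + (- t) * ln (r o)).
    apply: expect_le => // o _; apply: (Rle_trans _ (1 + - t * z o + 2 * (- t * z o) ^ 2)).
      apply: exp_le_quadratic; rewrite Rabs_mult Rabs_Ropp (Rabs_pos_eq t); last by lra.
      by apply: (Rle_trans _ (t * M)) => //; apply: Rmult_le_compat_l; [lra|].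
    have : z o ^ 2 <= M ^ 2 by rewrite -(pow2_abs (z o)); apply: pow_incr; split; [exact: Rabs_pos|].
    by rewrite /z => h; nra.
  rewrite expectD expectZl -/m expect_cst //; rewrite /d; nra.
have ed1 : Rabs (exp (- d)) < 1.
  rewrite Rabs_pos_eq; last by left; exact: exp_pos.
  by rewrite -exp_0; apply: exp_increasing; rewrite /d; lra.
have [N1 hN1] := pow_lt_1_zero th ltac:(by rewrite Rabs_pos_eq) (eps / 2) ltac:(lra).
have [N2 hN2] := pow_lt_1_zero (exp (- d)) ed1 (eps / 2) ltac:(lra).
exists (maxn N1 N2) => n; rewrite geq_max => /andP[nN1 nN2].
have expn x : exp x ^ n = exp (INR n * x).
  by rewrite -prod_cst prod_exp sum_cst.
exists (exp (INR n * d)); first exact: exp_pos.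
rewrite -exp_Ropp Ropp_mult_distr_r -(expn (- d)).
have /Rabs_def2[h2 _] := hN2 n (elimT leP nN2).
suff : prob (prodm (fun _ : 'I_n => P)) (fun h => ~~ Rleb (exp (INR n * d))
    (\big[Rmult/1]_(i < n) r (h i))) <= th ^ n.
  move=> h1; have /Rabs_def2[h3 _] := hN1 n (elimT leP nN1); lra.
(* Markov's inequality: on a failing block the [z] sum to a negative number, so the product of the
   [phi] exceeds 1. *)
rewrite -prod_cst -(expect_prodm (fun _ : 'I_n => P) (fun _ => phi)) probE.
apply: expect_le => [h|h Ph]; first by apply: prod_ge0.
have rh i : 0 < r (h i) by apply: r0; apply: (prodm_gt0 (mu := fun _ : 'I_n => P)).
rewrite prod_exp; case: RlebP => /= lt; first by left; exact: exp_pos.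
rewrite -exp_0; left; apply: exp_increasing.
have -> : \big[Rplus/0]_(i < n) (- t * z (h i)) = t * (INR n * d -
    \big[Rplus/0]_(i < n) ln (r (h i))).
  by rewrite -big_distrr /= /z /Rminus big_split /= sum_cst; ring.
apply: Rmult_lt_0_compat => //.
have : \big[Rplus/0]_(i < n) ln (r (h i)) < INR n * d; last by lra.
apply: exp_lt_inv; rewrite -prod_exp.
rewrite (eq_bigr (fun i => r (h i))) => [|i _]; last by rewrite exp_ln.
exact: Rnot_le_lt.
Qed.

(** * The information densities *)

Lemma cond_entropyE (Om : finType) (P : Om -> R) (A B : eqType) (X : Om -> A) (Y : Om -> B) :
  cond_entropy P X Y = - expect P (fun o =>
    ln (prob P (fun o' => (X o' == X o) && (Y o' == Y o)) / prob P (fun o' => Y o' == Y o))).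
Proof. by []. Qed.

(* [m] and [v] are the factors that extend the law of [Cv] to [Dv] and the law of [(X, Dv)] to
   [(X, Y, Dv)].  They cancel, so that the density equals pointwise the combination of
   conditional probabilities whose expected logarithm is I(X;Y|Dv) - H(S|Cv). *)
Lemma expect_ln_gt0 (Om : finType) (P : Om -> R) (A B C D E F : eqType)
    (S : Om -> A) (Cv : Om -> B) (X : Om -> C) (Y : Om -> D) (Dv : Om -> E)
    (Z : Om -> F) (kap : Om -> R) :
  is_pmf P -> cond_entropy P S Cv < cond_mutinfo P X Y Dv ->
  (forall o, 0 < P o -> exists v m, [/\
     prob P (fun o' => (Z o' == Z o) && ((Y o', Dv o') == (Y o, Dv o))) =
       prob P (fun o' => (S o' == S o) && (Cv o' == Cv o)) * (m * v * kap o),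
     prob P (fun o' => (X o' == X o) && ((Y o', Dv o') == (Y o, Dv o))) =
       prob P (fun o' => (X o' == X o) && (Dv o' == Dv o)) * v &
     prob P (fun o' => Dv o' == Dv o) = prob P (fun o' => Cv o' == Cv o) * m]) ->
  (forall o, 0 < P o -> 0 < prob P (fun o' => (Z o' == Z o) && ((Y o', Dv o') == (Y o, Dv o)))
     / (kap o * prob P (fun o' => (Y o', Dv o') == (Y o, Dv o)))) /\
  0 < expect P (fun o =>
    ln (prob P (fun o' => (Z o' == Z o) && ((Y o', Dv o') == (Y o, Dv o)))
     / (kap o * prob P (fun o' => (Y o', Dv o') == (Y o, Dv o))))).
Proof.
move=> [P0 P1] lt fact.
pose a o := prob P (fun o' => (S o' == S o) && (Cv o' == Cv o)).
pose b o := prob P (fun o' => Cv o' == Cv o).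
pose c o := prob P (fun o' => (X o' == X o) && (Dv o' == Dv o)).
pose d o := prob P (fun o' => Dv o' == Dv o).
pose e o := prob P (fun o' => (X o' == X o) && ((Y o', Dv o') == (Y o, Dv o))).
pose k o := prob P (fun o' => (Y o', Dv o') == (Y o, Dv o)).
pose z o := prob P (fun o' => (Z o' == Z o) && ((Y o', Dv o') == (Y o, Dv o))).
(* The three logarithms, with their signs, average to -H(S|Cv), H(X|Dv) and -H(X|Y,Dv). *)
have key o : 0 < P o -> 0 < z o / (kap o * k o) /\
    ln (z o / (kap o * k o)) = ln (a o / b o) + (-1) * ln (c o / d o) + ln (e o / k o).
  move=> Po; have [v [m [hz he hd]]] := fact o Po.
  rewrite -/(z o) -/(a o) -/(e o) -/(c o) -/(d o) -/(b o) in hz he hd.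
  have pos (E' : pred Om) : E' o -> 0 < prob P E' by move=> h; apply: prob_gt0 h.
  have a0 : 0 < a o by apply: pos; rewrite !eqxx.
  have b0 : 0 < b o by apply: pos; rewrite !eqxx.
  have c0 : 0 < c o by apply: pos; rewrite !eqxx.
  have d0 : 0 < d o by apply: pos; rewrite !eqxx.
  have e0 : 0 < e o by apply: pos; rewrite !eqxx.
  have k0 : 0 < k o by apply: pos; rewrite !eqxx.
  have z0 : 0 < z o by apply: pos; rewrite !eqxx.
  (* All seven probabilities are positive because [o] lies in each event; the factorisations pass
     this on to [v], [m] and [kap o]. *)
  have v0 : 0 < v by apply: (Rmult_lt_reg_l (c o)) => //; rewrite -he; lra.
  have m0 : 0 < m by apply: (Rmult_lt_reg_l (b o)) => //; rewrite -hd; lra.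
  have kap0 : 0 < kap o.
    apply: (Rmult_lt_reg_l (a o * m * v)); first by apply: Rmult_lt_0_compat => //; apply: Rmult_lt_0_compat.
    by have : a o * m * v * kap o = z o; [rewrite hz; ring|move=> ->; lra].
  have -> : z o / (kap o * k o) = a o / b o * (e o / k o) / (c o / d o).
    by rewrite hz he hd; field; do !split; lra.
  have ab0 : 0 < a o / b o by apply: Rdiv_lt_0_compat.
  have ek0 : 0 < e o / k o by apply: Rdiv_lt_0_compat.
  have cd0 : 0 < c o / d o by apply: Rdiv_lt_0_compat.
  have abek0 := Rmult_lt_0_compat _ _ ab0 ek0.
  split; first exact: Rdiv_lt_0_compat.
  rewrite [in ln (_ / (c o / d o))]/Rdiv ln_mult //; last exact: Rinv_0_lt_compat.
  by rewrite ln_mult // ln_Rinv //; lra.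
split=> [o Po|]; first by have [] := key o Po.
rewrite (@eq_expect_supp _ _ _ (fun o => ln (a o / b o) + (-1) * ln (c o / d o) + ln (e o / k o)))
  //; last by move=> o Po; have [] := key o Po.
rewrite !expectD expectZl.
move: lt; rewrite /cond_mutinfo !cond_entropyE; rewrite /a /b /c /d /e /k; lra.
Qed.

(** * One-shot random coding *)

Section Coding.
Variables (O Q S1 S2 U X1 X2 Y : finType).
Variables (pO : O -> R) (pQ : Q -> R) (p1 : Q -> S1 -> X1 -> R) (p2 : Q -> S2 -> X2 -> R).
Variables (V : X1 -> X2 -> Y -> R) (sg1 : O -> S1) (sg2 : O -> S2).
Variables (f : S1 -> U) (g : S2 -> U).

(** [O] carries both sources and all side information, [Y] the outputs at both receivers. The law
    serves at two scales: for single letters in the entropy conditions, and with whole blocks as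
    letters in the coding bound. *)
Definition joint_law : Q * O * X1 * X2 * Y -> R :=
  ext (ext (ext (ext pQ (fun=> pO)) (fun a => p1 a.1 (sg1 a.2)))
    (fun a => p2 a.1.1 (sg2 a.1.2))) (fun a => V a.1.2 a.2).

Notation code := ({ffun U -> Q} * {ffun S1 -> X1} * {ffun S2 -> X2})%type.

(* The three components are the map from common words to cloud centres and the two encoders. *)
Definition code_law : code -> R :=
  ext (ext (prodm (fun=> pQ)) (fun Phi : {ffun U -> Q} => prodm (fun s => p1 (Phi (f s)) s)))
    (fun c => prodm (fun s => p2 (c.1 (g s)) s)).

Hypotheses (pO_pmf : is_pmf pO) (pQ_pmf : is_pmf pQ).
Hypotheses (p1_pmf : forall q s, is_pmf (p1 q s)) (p2_pmf : forall q s, is_pmf (p2 q s)).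
Hypothesis V_pmf : forall x1 x2, is_pmf (V x1 x2).

Lemma joint_law_pmf : is_pmf joint_law.
Proof. by do 4 (apply: ext_pmf => //). Qed.

Lemma code_law_pmf : is_pmf code_law.
Proof.
apply: ext_pmf => [|c]; last exact: prodm_pmf.
by apply: ext_pmf => [|Phi]; apply: prodm_pmf.
Qed.

Lemma expect_joint_law F : expect joint_law F =
  expect pO (fun o => expect pQ (fun q => expect (p1 q (sg1 o)) (fun x1 =>
    expect (p2 q (sg2 o)) (fun x2 => expect (V x1 x2) (fun y => F (q, o, x1, x2, y)))))).
Proof. by rewrite !expect_ext /= expect_swap. Qed.

(** * Joint laws of true and wrong codewords under the random code *)

Lemma expect_code s1 s2 (G : Q -> X1 -> X2 -> R) : f s1 = g s2 ->
  expect code_law (fun c => G (c.1.1 (f s1)) (c.1.2 s1) (c.2 s2)) =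
  expect pQ (fun q => expect (p1 q s1) (fun x1 => expect (p2 q s2) (G q x1))).
Proof.
move=> fg; rewrite !expect_ext /=.
rewrite -(@expect_prodm1 U _ (fun=> pQ) _ (f s1)) //; apply: eq_expect => Phi.
rewrite -(@expect_prodm1 S1 _ (fun s => p1 (Phi (f s)) s)) //; apply: eq_expect => Psi1.
by rewrite (@expect_prodm1 S2 _ _ _ s2) // fg.
Qed.

(** A wrong [s1'] with the same common part shares the cloud centre; given the centre, its codeword
    is an independent draw. *)
Lemma expect_codeA s1 s1' s2 (G : Q -> X1 -> X1 -> X2 -> R) :
  f s1 = g s2 -> f s1' = f s1 -> s1 != s1' ->
  expect code_law (fun c => G (c.1.1 (f s1)) (c.1.2 s1) (c.1.2 s1') (c.2 s2)) =
  expect pQ (fun q => expect (p1 q s1) (fun x1 => expect (p1 q s1') (fun x1' =>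
    expect (p2 q s2) (G q x1 x1')))).
Proof.
move=> fg ff ne; rewrite !expect_ext /=.
rewrite -(@expect_prodm1 U _ (fun=> pQ) _ (f s1)) //; apply: eq_expect => Phi.
rewrite -[in X in _ = expect _ (fun x1 => expect X _)]ff.
rewrite -(@expect_prodm2 S1 _ (fun s => p1 (Phi (f s)) s)) //; apply: eq_expect => Psi1.
by rewrite (@expect_prodm1 S2 _ _ _ s2) // fg.
Qed.

Lemma expect_codeB s1 s2 s2' (G : Q -> X1 -> X2 -> X2 -> R) :
  f s1 = g s2 -> g s2' = g s2 -> s2 != s2' ->
  expect code_law (fun c => G (c.1.1 (f s1)) (c.1.2 s1) (c.2 s2) (c.2 s2')) =
  expect pQ (fun q => expect (p1 q s1) (fun x1 =>
    expect (p2 q s2) (fun x2 => expect (p2 q s2') (G q x1 x2)))).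
Proof.
move=> fg gg ne; rewrite !expect_ext /=.
rewrite -(@expect_prodm1 U _ (fun=> pQ) _ (f s1)) //; apply: eq_expect => Phi.
rewrite -(@expect_prodm1 S1 _ (fun s => p1 (Phi (f s)) s)) //; apply: eq_expect => Psi1.
by rewrite (@expect_prodm2 S2 _ _ _ s2 s2') // gg fg.
Qed.

Lemma expect_codeC s1 s1' s2 s2' (G : Q -> X1 -> X1 -> X2 -> X2 -> R) :
  f s1 = g s2 -> f s1' = f s1 -> g s2' = g s2 -> s1 != s1' -> s2 != s2' ->
  expect code_law (fun c => G (c.1.1 (f s1)) (c.1.2 s1) (c.1.2 s1') (c.2 s2) (c.2 s2')) =
  expect pQ (fun q => expect (p1 q s1) (fun x1 => expect (p1 q s1') (fun x1' =>
    expect (p2 q s2) (fun x2 => expect (p2 q s2') (G q x1 x1' x2))))).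
Proof.
move=> fg ff gg ne1 ne2; rewrite !expect_ext /=.
rewrite -(@expect_prodm1 U _ (fun=> pQ) _ (f s1)) //; apply: eq_expect => Phi.
rewrite -[in X in _ = expect _ (fun x1 => expect X _)]ff.
rewrite -(@expect_prodm2 S1 _ (fun s => p1 (Phi (f s)) s)) //; apply: eq_expect => Psi1.
by rewrite (@expect_prodm2 S2 _ _ _ s2 s2') // gg fg.
Qed.

(** Distinct common parts have independent cloud centres and force both source words to differ, so
    everything drawn for the wrong pair is independent of what is sent. *)
Lemma expect_codeD s1 s1' s2 s2' (G : Q -> X1 -> X1 -> X2 -> X2 -> R) :
  f s1 = g s2 -> f s1' = g s2' -> f s1 != f s1' ->
  expect code_law (fun c => G (c.1.1 (f s1')) (c.1.2 s1) (c.1.2 s1') (c.2 s2) (c.2 s2')) =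
  expect pQ (fun q => expect pQ (fun q' => expect (p1 q s1) (fun x1 =>
    expect (p1 q' s1') (fun x1' => expect (p2 q s2) (fun x2 =>
    expect (p2 q' s2') (G q' x1 x1' x2)))))).
Proof.
move=> fg fg' ne; rewrite !expect_ext /=.
have ne1 : s1 != s1' by apply: contraNneq ne => ->.
have ne2 : s2 != s2' by apply: contraNneq ne; rewrite fg fg' => ->.
rewrite -(@expect_prodm2 U _ (fun=> pQ) _ (f s1) (f s1')) //; apply: eq_expect => Phi.
rewrite -(@expect_prodm2 S1 _ (fun s => p1 (Phi (f s)) s)) //; apply: eq_expect => Psi1.
by rewrite (@expect_prodm2 S2 _ _ _ s2 s2') // fg fg'.
Qed.

Lemma indic_le_sum (T : finType) (D E : pred T) x : D x -> E x ->
  1 <= \big[Rplus/0]_(y | D y) indic (E y).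
Proof.
move=> Dx Ex; rewrite (bigD1 x) //= Ex /=.
set S := \big[Rplus/0]_(i | _) _.
have : 0 <= S by apply: sum_ge0 => i _; exact: indic_ge0.
lra.
Qed.

Lemma sum_le_subset (T : finType) (D : pred T) (F : T -> R) : (forall x, 0 <= F x) ->
  \big[Rplus/0]_(x | D x) F x <= \big[Rplus/0]_x F x.
Proof.
by move=> F0; rewrite big_mkcond; apply: sum_le => x _; case: (D x) => //; lra.
Qed.

Section Receiver.
Variables (WT YT : finType) (om : O -> WT) (eta : Y -> YT).

(* In test i, [Zi] is the part of the outcome that a wrong candidate redraws, [Ki] the part
   that it shares with the truth, and [kapi] the weight of [Zi] given [Ki] for a fresh
   candidate, with counting weight on the source words. *)
Definition Z1 (j : Q * O * X1 * X2 * Y) := (sg1 j.1.1.1.2, j.1.1.2).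
Definition K1 (j : Q * O * X1 * X2 * Y) :=
  (eta j.2, (j.1.2, sg2 j.1.1.1.2, om j.1.1.1.2, j.1.1.1.1)).
Definition kap1 (z : S1 * X1) (k : YT * (X2 * S2 * WT * Q)) := p1 k.2.2 z.1 z.2.

Definition Z2 (j : Q * O * X1 * X2 * Y) := (sg2 j.1.1.1.2, j.1.2).
Definition K2 (j : Q * O * X1 * X2 * Y) :=
  (eta j.2, (j.1.1.2, sg1 j.1.1.1.2, om j.1.1.1.2, j.1.1.1.1)).
Definition kap2 (z : S2 * X2) (k : YT * (X1 * S1 * WT * Q)) := p2 k.2.2 z.1 z.2.

Definition Z3 (j : Q * O * X1 * X2 * Y) :=
  (sg1 j.1.1.1.2, sg2 j.1.1.1.2, j.1.1.2, j.1.2).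
Definition K3 (j : Q * O * X1 * X2 * Y) :=
  (eta j.2, (f (sg1 j.1.1.1.2), om j.1.1.1.2, j.1.1.1.1)).
Definition kap3 (z : S1 * S2 * X1 * X2) (k : YT * (U * WT * Q)) :=
  p1 k.2.2 z.1.1.1 z.1.2 * p2 k.2.2 z.1.1.2 z.2.

Definition Z4 (j : Q * O * X1 * X2 * Y) :=
  (sg1 j.1.1.1.2, sg2 j.1.1.1.2, j.1.1.1.1, j.1.1.2, j.1.2).
Definition K4 (j : Q * O * X1 * X2 * Y) := (eta j.2, om j.1.1.1.2).
Definition kap4 (z : S1 * S2 * Q * X1 * X2) (k : YT * WT) :=
  pQ z.1.1.2 * (p1 z.1.1.2 z.1.1.1.1 z.1.2 * p2 z.1.1.2 z.1.1.1.2 z.2).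

Notation test1 := (passes joint_law Z1 K1 kap1).
Notation test2 := (passes joint_law Z2 K2 kap2).
Notation test3 := (passes joint_law Z3 K3 kap3).
Notation test4 := (passes joint_law Z4 K4 kap4).

(** * The decoder and its union bound *)

Section Decoder.
Variables (L1 L2 L3 L4 : R) (s0 : S1 * S2).

Definition accepts (c : code)
    (y : YT) (w : WT) (s : S1 * S2) : bool :=
  let q := c.1.1 (f s.1) in let x1 := c.1.2 s.1 in let x2 := c.2 s.2 in
  [&& f s.1 == g s.2, test1 L1 (s.1, x1) (y, (x2, s.2, w, q)),
      test2 L2 (s.2, x2) (y, (x1, s.1, w, q)),
      test3 L3 (s.1, s.2, x1, x2) (y, (f s.1, w, q))
    & test4 L4 (s.1, s.2, q, x1, x2) (y, w)].

(** Any accepted pair may be returned: if several are accepted, a wrong one is among them and is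
    counted in the union bound. [s0] is the output when none is accepted. *)
Definition decode c (yw : YT * WT) : S1 * S2 :=
  odflt s0 [pick s | accepts c yw.1 yw.2 s].

(** On an error either the true pair fails a test, or the returned wrong pair has passed the test of
    its class and makes the corresponding sum at least 1. *)
Lemma decode_error (c : code) y w s1 s2 :
  f s1 = g s2 ->
  let q := c.1.1 (f s1) in let x1 := c.1.2 s1 in let x2 := c.2 s2 in
  indic (decode c (y, w) != (s1, s2)) <=
    ((indic (~~ test1 L1 (s1, x1) (y, (x2, s2, w, q))) +
      \big[Rplus/0]_(s1' | (f s1' == f s1) && (s1 != s1'))
         indic (test1 L1 (s1', c.1.2 s1') (y, (x2, s2, w, q)))) +
     (indic (~~ test2 L2 (s2, x2) (y, (x1, s1, w, q))) +
      \big[Rplus/0]_(s2' | (g s2' == g s2) && (s2 != s2'))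
         indic (test2 L2 (s2', c.2 s2') (y, (x1, s1, w, q))))) +
    ((indic (~~ test3 L3 (s1, s2, x1, x2) (y, (f s1, w, q))) +
      \big[Rplus/0]_(s' | [&& f s'.1 == f s1, g s'.2 == g s2, s1 != s'.1 & s2 != s'.2])
         indic (test3 L3 (s'.1, s'.2, c.1.2 s'.1, c.2 s'.2) (y, (f s1, w, q)))) +
     (indic (~~ test4 L4 (s1, s2, q, x1, x2) (y, w)) +
      \big[Rplus/0]_(s' | (f s'.1 == g s'.2) && (f s1 != f s'.1))
         indic (test4 L4 (s'.1, s'.2, c.1.1 (f s'.1), c.1.2 s'.1, c.2 s'.2) (y, w)))).
Proof.
move=> fg q x1 x2.
set A1 := indic (~~ test1 _ _ _); set A2 := indic (~~ test2 _ _ _).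
set A3 := indic (~~ test3 _ _ _); set A4 := indic (~~ test4 _ _ _).
set B1 := \big[Rplus/0]_(s1' | _) _; set B2 := \big[Rplus/0]_(s2' | _) _.
set B3 := \big[Rplus/0]_(s' | _) _; set B4 := \big[Rplus/0]_(s' | _) _.
have [a1 a2 a3 a4] : [/\ 0 <= A1, 0 <= A2, 0 <= A3 & 0 <= A4] by split; exact: indic_ge0.
have [b1 b2 b3 b4] : [/\ 0 <= B1, 0 <= B2, 0 <= B3 & 0 <= B4].
  by split; apply: sum_ge0 => i _; exact: indic_ge0.
case: eqP => [_|ne] /=; first by lra.
have [acc|] := boolP (accepts c y w (s1, s2)); last first.
  move: a1 a2 a3 a4; rewrite /accepts /= fg eqxx -fg /= /A1 /A2 /A3 /A4 /x1 /x2 /q.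
  case: (test1 L1 _ _); case: (test2 L2 _ _); case: (test3 L3 _ _);
    case: (test4 L4 _ _) => //=; lra.
move: ne; rewrite /decode; case: pickP => [[s1' s2'] /= acc' ne|/(_ (s1, s2))]; last by rewrite /= acc.
move: acc'; rewrite /accepts /= => /and5P[/eqP fg' t1 t2 t3 t4].
(* The wrong pair is classified first by its common part, then by which words are right. If the
   common part is right, so is the cloud centre. *)
have [ff|nff] := eqVneq (f s1') (f s1); last first.
  have : 1 <= B4; last by lra.
  by apply: (@indic_le_sum _ _ _ (s1', s2')); rewrite //= fg' eqxx eq_sym -fg'.
have gg : g s2' = g s2 by rewrite -fg' ff.
have [e1|ne1] := eqVneq s1 s1'.
  have ne2 : s2 != s2' by apply/eqP => e2; apply: ne; rewrite e1 e2.
  have : 1 <= B2; last by lra.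
  by apply: (@indic_le_sum _ _ _ s2'); rewrite ?gg ?eqxx // /x1 /q e1.
have [e2|ne2] := eqVneq s2 s2'.
  have : 1 <= B1; last by lra.
  by apply: (@indic_le_sum _ _ _ s1'); rewrite ?ff ?eqxx // /x2 /q e2 -ff.
have : 1 <= B3; last by lra.
apply: (@indic_le_sum _ _ _ (s1', s2')); rewrite /= ?ff ?gg ?eqxx ?ne1 ?ne2 //.
by rewrite /q -ff.
Qed.

(** * Expected contributions of the true pair and of the wrong candidates *)

Hypothesis common : forall o, 0 < pO o -> f (sg1 o) = g (sg2 o).
Hypotheses (L1_gt0 : 0 < L1) (L2_gt0 : 0 < L2) (L3_gt0 : 0 < L3) (L4_gt0 : 0 < L4).

(** On the support of [pO] the two encoders use the same cloud centre, so the transmission follows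
    [joint_law]. *)
Lemma expect_true (G : Q * O * X1 * X2 * Y -> R) :
  expect pO (fun o => expect code_law (fun c => let x1 := c.1.2 (sg1 o) in
    let x2 := c.2 (sg2 o) in expect (V x1 x2) (fun y =>
    G (c.1.1 (f (sg1 o)), o, x1, x2, y)))) = expect joint_law G.
Proof.
rewrite expect_joint_law; apply: eq_expect_supp => [|o /common fg]; first by case: pO_pmf.
exact: (expect_code (fun q x1 x2 => expect (V x1 x2) (fun y => G (q, o, x1, x2, y)))).
Qed.

(** Given the true centre, the codeword of a wrong word is independent of the output. Summing over
    words and codewords thus reproduces the weight [kap1]. *)
Lemma expect_wrong1 : expect pO (fun o => expect code_law (fun c =>
    let x1 := c.1.2 (sg1 o) in let x2 := c.2 (sg2 o) in expect (V x1 x2) (fun y =>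
    \big[Rplus/0]_(s1' | (f s1' == f (sg1 o)) && (sg1 o != s1'))
      indic (test1 L1 (s1', c.1.2 s1') (eta y, (x2, sg2 o, om o, c.1.1 (f (sg1 o)))))))) <= / L1.
Proof.
apply: Rle_trans (expect_passes Z1 K1 kap1 joint_law_pmf L1_gt0).
rewrite expect_joint_law; apply: expect_le => [|o /common fg]; first by case: pO_pmf.
have p10 q s x : 0 <= p1 q s x by case: (p1_pmf q s).
have p20 q s x : 0 <= p2 q s x by case: (p2_pmf q s).
have pQ0 q : 0 <= pQ q by case: pQ_pmf.
have V0 x1 x2 y : 0 <= V x1 x2 y by case: (V_pmf x1 x2).
rewrite /= (@eq_expect _ _ _ (fun c : code => \big[Rplus/0]_(s1' | (f s1' == f (sg1 o)) && (sg1 o != s1'))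
  expect (V (c.1.2 (sg1 o)) (c.2 (sg2 o))) (fun y =>
   indic (test1 L1 (s1', c.1.2 s1') (eta y, (c.2 (sg2 o), sg2 o, om o, c.1.1 (f (sg1 o)))))))); last first.
  by move=> c; rewrite expect_sum.
rewrite expect_sum.
pose G s1' q x1 x1' x2 := expect (V x1 x2) (fun y =>
  indic (test1 L1 (s1', x1') (eta y, (x2, sg2 o, om o, q)))).
rewrite (eq_bigr (fun s1' => expect pQ (fun q => expect (p1 q (sg1 o)) (fun x1 =>
   expect (p1 q s1') (fun x1' => expect (p2 q (sg2 o)) (G s1' q x1 x1')))))); last first.
  by move=> s1' /andP[/eqP ff ne]; rewrite -(expect_codeA (G s1')).
(* Dropping the restrictions on [s1'] only enlarges the sum; [kap1] weighs all of [S1]. *)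
apply: Rle_trans (sum_le_subset _ _) _ => [s|]; first by do !apply: expect_ge0 => // ?; exact: indic_ge0.
right; rewrite -expect_sum; apply: eq_expect => q.
rewrite -expect_sum; apply: eq_expect => x1.
(* The average over the wrong codeword is moved past [x2] and [y], to merge with the sum over [s1']
   into one sum over [z]. *)
under eq_bigr do rewrite expect_swap; rewrite -expect_sum; apply: eq_expect => x2.
under eq_bigr do rewrite expect_swap; rewrite -expect_sum; apply: eq_expect => y.
by rewrite pair_bigA; apply: eq_bigr => -[s x] _.
Qed.

Lemma expect_wrong2 : expect pO (fun o => expect code_law (fun c =>
    let x1 := c.1.2 (sg1 o) in let x2 := c.2 (sg2 o) in expect (V x1 x2) (fun y =>
    \big[Rplus/0]_(s2' | (g s2' == g (sg2 o)) && (sg2 o != s2'))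
      indic (test2 L2 (s2', c.2 s2') (eta y, (x1, sg1 o, om o, c.1.1 (f (sg1 o)))))))) <= / L2.
Proof.
apply: Rle_trans (expect_passes Z2 K2 kap2 joint_law_pmf L2_gt0).
rewrite expect_joint_law; apply: expect_le => [|o /common fg]; first by case: pO_pmf.
have p10 q s x : 0 <= p1 q s x by case: (p1_pmf q s).
have p20 q s x : 0 <= p2 q s x by case: (p2_pmf q s).
have pQ0 q : 0 <= pQ q by case: pQ_pmf.
have V0 x1 x2 y : 0 <= V x1 x2 y by case: (V_pmf x1 x2).
rewrite /= (@eq_expect _ _ _ (fun c : code => \big[Rplus/0]_(s2' | (g s2' == g (sg2 o)) && (sg2 o != s2'))
  expect (V (c.1.2 (sg1 o)) (c.2 (sg2 o))) (fun y =>
   indic (test2 L2 (s2', c.2 s2') (eta y, (c.1.2 (sg1 o), sg1 o, om o, c.1.1 (f (sg1 o)))))))); last first.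
  by move=> c; rewrite expect_sum.
rewrite expect_sum.
pose G s2' q x1 x2 x2' := expect (V x1 x2) (fun y =>
  indic (test2 L2 (s2', x2') (eta y, (x1, sg1 o, om o, q)))).
rewrite (eq_bigr (fun s2' => expect pQ (fun q => expect (p1 q (sg1 o)) (fun x1 =>
   expect (p2 q (sg2 o)) (fun x2 => expect (p2 q s2') (G s2' q x1 x2)))))); last first.
  by move=> s2' /andP[/eqP gg ne]; rewrite -(expect_codeB (G s2')).
apply: Rle_trans (sum_le_subset _ _) _ => [s|]; first by do !apply: expect_ge0 => // ?; exact: indic_ge0.
right; rewrite -expect_sum; apply: eq_expect => q.
rewrite -expect_sum; apply: eq_expect => x1.
rewrite -expect_sum; apply: eq_expect => x2.
under eq_bigr do rewrite expect_swap; rewrite -expect_sum; apply: eq_expect => y.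
by rewrite pair_bigA; apply: eq_bigr => -[s x] _.
Qed.

Lemma expect_wrong3 : expect pO (fun o => expect code_law (fun c =>
    let x1 := c.1.2 (sg1 o) in let x2 := c.2 (sg2 o) in expect (V x1 x2) (fun y =>
    \big[Rplus/0]_(s' | [&& f s'.1 == f (sg1 o), g s'.2 == g (sg2 o), sg1 o != s'.1 & sg2 o != s'.2])
      indic (test3 L3 (s'.1, s'.2, c.1.2 s'.1, c.2 s'.2)
        (eta y, (f (sg1 o), om o, c.1.1 (f (sg1 o)))))))) <= / L3.
Proof.
apply: Rle_trans (expect_passes Z3 K3 kap3 joint_law_pmf L3_gt0).
rewrite expect_joint_law; apply: expect_le => [|o /common fg]; first by case: pO_pmf.
have p10 q s x : 0 <= p1 q s x by case: (p1_pmf q s).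
have p20 q s x : 0 <= p2 q s x by case: (p2_pmf q s).
have pQ0 q : 0 <= pQ q by case: pQ_pmf.
have V0 x1 x2 y : 0 <= V x1 x2 y by case: (V_pmf x1 x2).
rewrite /= (@eq_expect _ _ _ (fun c : code => \big[Rplus/0]_(s' : S1 * S2 | [&& f s'.1 == f (sg1 o),
     g s'.2 == g (sg2 o), sg1 o != s'.1 & sg2 o != s'.2])
  expect (V (c.1.2 (sg1 o)) (c.2 (sg2 o))) (fun y =>
   indic (test3 L3 (s'.1, s'.2, c.1.2 s'.1, c.2 s'.2)
        (eta y, (f (sg1 o), om o, c.1.1 (f (sg1 o)))))))); last first.
  by move=> c; rewrite expect_sum.
rewrite expect_sum.
pose G (s' : S1 * S2) q x1 x1' x2 x2' := expect (V x1 x2) (fun y =>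
  indic (test3 L3 (s'.1, s'.2, x1', x2') (eta y, (f (sg1 o), om o, q)))).
rewrite (eq_bigr (fun s' => expect pQ (fun q => expect (p1 q (sg1 o)) (fun x1 =>
   expect (p1 q s'.1) (fun x1' => expect (p2 q (sg2 o)) (fun x2 =>
   expect (p2 q s'.2) (G s' q x1 x1' x2))))))); last first.
  by move=> s' /and4P[/eqP ff /eqP gg ne1 ne2]; rewrite -(expect_codeC (G s')).
apply: Rle_trans (sum_le_subset _ _) _ => [s|]; first by do !apply: expect_ge0 => // ?; exact: indic_ge0.
right; rewrite -expect_sum; apply: eq_expect => q.
rewrite -expect_sum; apply: eq_expect => x1.
under eq_bigr do rewrite expect_swap; rewrite -expect_sum; apply: eq_expect => x2.
under eq_bigr => s' _ do under eq_expect do rewrite expect_swap.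
under eq_bigr do rewrite expect_swap; rewrite -expect_sum; apply: eq_expect => y.
rewrite /expect; under eq_bigr do under eq_bigr do rewrite big_distrr /=.
rewrite pair_bigA pair_bigA; apply: eq_bigr => -[[[s1' s2'] x] x'] _ /=; exact/esym/Rmult_assoc.
Qed.

(** The wrong centre is a fresh draw too and belongs to [z]; only the output and the side
    information are shared. *)
Lemma expect_wrong4 : expect pO (fun o => expect code_law (fun c =>
    let x1 := c.1.2 (sg1 o) in let x2 := c.2 (sg2 o) in expect (V x1 x2) (fun y =>
    \big[Rplus/0]_(s' | (f s'.1 == g s'.2) && (f (sg1 o) != f s'.1))
      indic (test4 L4 (s'.1, s'.2, c.1.1 (f s'.1), c.1.2 s'.1, c.2 s'.2)
        (eta y, om o))))) <= / L4.
Proof.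
apply: Rle_trans (expect_passes Z4 K4 kap4 joint_law_pmf L4_gt0).
rewrite expect_joint_law; apply: expect_le => [|o /common fg]; first by case: pO_pmf.
have p10 q s x : 0 <= p1 q s x by case: (p1_pmf q s).
have p20 q s x : 0 <= p2 q s x by case: (p2_pmf q s).
have pQ0 q : 0 <= pQ q by case: pQ_pmf.
have V0 x1 x2 y : 0 <= V x1 x2 y by case: (V_pmf x1 x2).
rewrite /= (@eq_expect _ _ _ (fun c : code => \big[Rplus/0]_(s' : S1 * S2 |
     (f s'.1 == g s'.2) && (f (sg1 o) != f s'.1))
  expect (V (c.1.2 (sg1 o)) (c.2 (sg2 o))) (fun y =>
   indic (test4 L4 (s'.1, s'.2, c.1.1 (f s'.1), c.1.2 s'.1, c.2 s'.2)
        (eta y, om o))))); last first.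
  by move=> c; rewrite expect_sum.
rewrite expect_sum.
pose G (s' : S1 * S2) q x1 x1' x2 x2' := expect (V x1 x2) (fun y =>
  indic (test4 L4 (s'.1, s'.2, q, x1', x2') (eta y, om o))).
rewrite (eq_bigr (fun s' => expect pQ (fun q => expect pQ (fun q' =>
   expect (p1 q (sg1 o)) (fun x1 =>
   expect (p1 q' s'.1) (fun x1' => expect (p2 q (sg2 o)) (fun x2 =>
   expect (p2 q' s'.2) (G s' q' x1 x1' x2)))))))); last first.
  by move=> s' /andP[/eqP fg' ne]; rewrite -(expect_codeD (G s')).
apply: Rle_trans (sum_le_subset _ _) _ => [s|]; first by do !apply: expect_ge0 => // ?; exact: indic_ge0.
right; rewrite -expect_sum; apply: eq_expect => q.
under eq_bigr do rewrite expect_swap; rewrite -expect_sum; apply: eq_expect => x1.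
under eq_bigr => s' _ do under eq_expect do rewrite expect_swap.
under eq_bigr do rewrite expect_swap; rewrite -expect_sum; apply: eq_expect => x2.
under eq_bigr => s' _ do under eq_expect => q' do under eq_expect do rewrite expect_swap.
under eq_bigr => s' _ do under eq_expect do rewrite expect_swap.
under eq_bigr do rewrite expect_swap; rewrite -expect_sum; apply: eq_expect => y.
rewrite /expect; under eq_bigr do under eq_bigr do rewrite big_distrr /=.
rewrite pair_bigA; under eq_bigr do under eq_bigr do rewrite !big_distrr /=.
rewrite pair_bigA pair_bigA; apply: eq_bigr => -[[[[s1' s2'] q'] x] x'] _ /=; by rewrite [in RHS]/kap4 /= !Rmult_assoc.
Qed.

(** [F] may depend on the code, so that the errors of both receivers can be added under one random
    code. *)
Definition average (F : O -> code -> Y -> R) : R :=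
  expect pO (fun o => expect code_law (fun c =>
    expect (V (c.1.2 (sg1 o)) (c.2 (sg2 o))) (F o c))).

Lemma averageD F G :
  average (fun o c y => F o c y + G o c y) = average F + average G.
Proof.
rewrite /average -expectD; apply: eq_expect => o.
by rewrite -expectD; apply: eq_expect => c; rewrite -expectD.
Qed.

Lemma average_decode_error :
  average (fun o c y => indic (decode c (eta y, om o) != (sg1 o, sg2 o))) <=
    ((prob joint_law (fun j => ~~ test1 L1 (Z1 j) (K1 j)) + / L1) +
     (prob joint_law (fun j => ~~ test2 L2 (Z2 j) (K2 j)) + / L2)) +
    ((prob joint_law (fun j => ~~ test3 L3 (Z3 j) (K3 j)) + / L3) +
     (prob joint_law (fun j => ~~ test4 L4 (Z4 j) (K4 j)) + / L4)).
Proof.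
rewrite !probE -!expect_true; apply: Rle_trans; last first.
  apply: Rplus_le_compat; apply: Rplus_le_compat; apply: Rplus_le_compat_l.
  - exact: expect_wrong1.
  - exact: expect_wrong2.
  - exact: expect_wrong3.
  - exact: expect_wrong4.
rewrite -!averageD; apply: expect_le => [|o /common fg]; first by case: pO_pmf.
apply: expect_le => [|c _]; first by case: code_law_pmf.
apply: expect_le => [|y _]; first by case: (V_pmf (c.1.2 (sg1 o)) (c.2 (sg2 o))).
exact: decode_error.
Qed.

End Decoder.

(** * Marginals of the joint law *)

Lemma prob_joint_y (E : pred (Q * O * X1 * X2)) x1 x2 y :
  (forall a, E a -> a.1.2 = x1 /\ a.2 = x2) ->
  prob joint_law (fun j => E j.1 && (eta j.2 == y)) =
  prob joint_law (fun j => E j.1) * prob (V x1 x2) (fun y' => eta y' == y).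
Proof.
move=> h; rewrite prob_ext1; last by move=> a; case: (V_pmf a.1.2 a.2).
by rewrite -(@prob_ext _ _ _ (fun a => V a.1.2 a.2) _ (fun y' => eta y' == y)) // => a /h[-> ->].
Qed.

Lemma prob_joint_src (E : pred (Q * O)) :
  prob joint_law (fun j => E j.1.1.1) = prob (ext pQ (fun=> pO)) E.
Proof.
rewrite /joint_law (prob_ext1 _ (fun a => E a.1.1)); last by move=> a; case: (V_pmf a.1.2 a.2).
rewrite (prob_ext1 _ (fun a => E a.1)); last by move=> a; case: (p2_pmf a.1.1 (sg2 a.1.2)).
by rewrite (prob_ext1 _ E) // => a; case: (p1_pmf a.1 (sg1 a.2)).
Qed.

Lemma prob_joint_x1 (E : pred (Q * O)) q s1 x1 :
  (forall a, E a -> a.1 = q /\ sg1 a.2 = s1) ->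
  prob joint_law (fun j => E j.1.1.1 && (j.1.1.2 == x1)) =
  prob joint_law (fun j => E j.1.1.1) * p1 q s1 x1.
Proof.
move=> h; rewrite prob_joint_src.
rewrite /joint_law (prob_ext1 _ (fun a => E a.1.1 && (a.1.2 == x1))); last first.
  by move=> a; case: (V_pmf a.1.2 a.2).
rewrite (prob_ext1 _ (fun a => E a.1 && (a.2 == x1))); last first.
  by move=> a; case: (p2_pmf a.1.1 (sg2 a.1.2)).
by rewrite (@prob_ext _ _ _ _ E (fun x => x == x1) (p1 q s1 x1)) // => a /h[-> ->];
  rewrite prob_pred1.
Qed.

Lemma prob_joint_x2 (E : pred (Q * O)) q s2 x2 :
  (forall a, E a -> a.1 = q /\ sg2 a.2 = s2) ->
  prob joint_law (fun j => E j.1.1.1 && (j.1.2 == x2)) =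
  prob joint_law (fun j => E j.1.1.1) * p2 q s2 x2.
Proof.
move=> h; rewrite prob_joint_src.
rewrite /joint_law (prob_ext1 _ (fun a => E a.1.1 && (a.2 == x2))); last first.
  by move=> a; case: (V_pmf a.1.2 a.2).
rewrite (@prob_ext _ _ _ _ (fun a => E a.1) (fun x => x == x2) (p2 q s2 x2)); last first.
  by move=> a /h[-> ->]; rewrite prob_pred1.
by rewrite (prob_ext1 _ E) // => a; case: (p1_pmf a.1 (sg1 a.2)).
Qed.

Lemma prob_joint_x12 (E : pred (Q * O)) q s1 s2 x1 x2 :
  (forall a, E a -> [/\ a.1 = q, sg1 a.2 = s1 & sg2 a.2 = s2]) ->
  prob joint_law (fun j => E j.1.1.1 && (j.1.1.2 == x1) && (j.1.2 == x2)) =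
  prob joint_law (fun j => E j.1.1.1) * (p1 q s1 x1 * p2 q s2 x2).
Proof.
move=> h; rewrite prob_joint_src.
rewrite /joint_law (prob_ext1 _ (fun a => E a.1.1 && (a.1.2 == x1) && (a.2 == x2))); last first.
  by move=> a; case: (V_pmf a.1.2 a.2).
rewrite (@prob_ext _ _ _ _ (fun a => E a.1 && (a.2 == x1)) (fun x => x == x2) (p2 q s2 x2));
  last by move=> a /andP[/h[-> _ ->] _]; rewrite prob_pred1.
rewrite (@prob_ext _ _ _ _ E (fun x => x == x1) (p1 q s1 x1)); last first.
  by move=> a /h[-> -> _]; rewrite prob_pred1.
exact: Rmult_assoc.
Qed.

Lemma prob_joint_q (E : pred O) q :
  prob joint_law (fun j => (j.1.1.1.1 == q) && E j.1.1.1.2) =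
  prob joint_law (fun j => E j.1.1.1.2) * pQ q.
Proof.
rewrite (prob_joint_src (fun a => (a.1 == q) && E a.2)) (prob_joint_src (fun a => E a.2)).
rewrite (@prob_ext _ _ _ _ (fun x => x == q) E (prob pO E)) // prob_pred1.
rewrite -[X in prob X (fun a : Q * O => E a.2)]/(ext pQ (fun=> pO)).
rewrite (@prob_ext _ _ pQ _ predT E (prob pO E)) //.
have -> : prob pQ predT = 1 by case: pQ_pmf.
ring.
Qed.

(** [F] fixes both source words, so every kernel is evaluated at fixed arguments and factors out. *)
Lemma prob_joint_full (F : pred O) q s1 s2 x1 x2 y :
  (forall o, F o -> sg1 o = s1 /\ sg2 o = s2) ->
  prob joint_law (fun j => ((((j.1.1.1.1 == q) && F j.1.1.1.2) && (j.1.1.2 == x1))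
    && (j.1.2 == x2)) && (eta j.2 == y)) =
  prob joint_law (fun j => F j.1.1.1.2) *
    (pQ q * (p1 q s1 x1 * p2 q s2 x2) * prob (V x1 x2) (fun y' => eta y' == y)).
Proof.
move=> h.
rewrite (@prob_joint_y (fun a => (((a.1.1.1 == q) && F a.1.1.2) && (a.1.2 == x1))
  && (a.2 == x2)) x1 x2); last by move=> a /andP[/andP[_ /eqP ->] /eqP ->].
rewrite (@prob_joint_x12 (fun a => (a.1 == q) && F a.2) q s1 s2); last first.
  by move=> a /andP[/eqP -> /h[-> ->]].
by rewrite prob_joint_q; ring.
Qed.

(** Equates conjunctions of the same equality tests in different orders and groupings. *)
Ltac bool_ac := rewrite /= ?xpair_eqE;
  repeat match goal with |- context [?a == ?b] => case: (a == b) end; done.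

(** * From the entropy conditions to informative tests *)

Lemma informative1 :
  cond_entropy joint_law (fun j => sg1 j.1.1.1.2) (fun j => (sg2 j.1.1.1.2, om j.1.1.1.2)) <
  cond_mutinfo joint_law (fun j => j.1.1.2) (fun j => eta j.2)
    (fun j => (j.1.2, sg2 j.1.1.1.2, om j.1.1.1.2, j.1.1.1.1)) ->
  informative joint_law Z1 K1 kap1.
Proof.
move=> lt; apply: (expect_ln_gt0 (kap := fun j => kap1 (Z1 j) (K1 j)) joint_law_pmf lt).
move=> [[[[q o] x1] x2] y] _ /=.
(* [v] is the probability of the received output given the inputs, [m] that of the centre and [x2]
   given [s2] and the side information. *)
exists (prob (V x1 x2) (fun y' => eta y' == eta y)), (pQ q * p2 q (sg2 o) x2); split.
- rewrite (@eq_prob _ _ _ (fun j => ((((j.1.1.1.1 == q) && [&& sg1 j.1.1.1.2 == sg1 o,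
    sg2 j.1.1.1.2 == sg2 o & om j.1.1.1.2 == om o]) && (j.1.1.2 == x1)) && (j.1.2 == x2))
    && (eta j.2 == eta y))); last by move=> j; rewrite /Z1; bool_ac.
  rewrite (@prob_joint_full (fun o' => [&& sg1 o' == sg1 o, sg2 o' == sg2 o & om o' == om o])
    _ (sg1 o) (sg2 o)); last by move=> o' /and3P[/eqP -> /eqP ->].
  rewrite /kap1 /=; congr (_ * _); ring.
- rewrite -(@prob_joint_y (fun a => (a.1.2 == x1) &&
    ((a.2, sg2 a.1.1.2, om a.1.1.2, a.1.1.1) == (x2, sg2 o, om o, q)))); last first.
    by move=> a; rewrite !xpair_eqE => /andP[/eqP -> /andP[/andP[/andP[/eqP -> _] _] _]].
  by apply: eq_prob => j; bool_ac.
- rewrite (@eq_prob _ _ _ (fun j => ((j.1.1.1.1 == q) && ((sg2 j.1.1.1.2 == sg2 o) &&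
    (om j.1.1.1.2 == om o))) && (j.1.2 == x2))); last by move=> j; bool_ac.
  rewrite (@prob_joint_x2 (fun a => (a.1 == q) && ((sg2 a.2 == sg2 o) && (om a.2 == om o)))
    q (sg2 o)); last by move=> a /and3P[/eqP -> /eqP ->].
  rewrite (prob_joint_q (fun o' => (sg2 o' == sg2 o) && (om o' == om o))).
  exact: Rmult_assoc.
Qed.

Lemma informative2 :
  cond_entropy joint_law (fun j => sg2 j.1.1.1.2) (fun j => (sg1 j.1.1.1.2, om j.1.1.1.2)) <
  cond_mutinfo joint_law (fun j => j.1.2) (fun j => eta j.2)
    (fun j => (j.1.1.2, sg1 j.1.1.1.2, om j.1.1.1.2, j.1.1.1.1)) ->
  informative joint_law Z2 K2 kap2.
Proof.
move=> lt; apply: (expect_ln_gt0 (kap := fun j => kap2 (Z2 j) (K2 j)) joint_law_pmf lt).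
move=> [[[[q o] x1] x2] y] _ /=.
exists (prob (V x1 x2) (fun y' => eta y' == eta y)), (pQ q * p1 q (sg1 o) x1); split.
- rewrite (@eq_prob _ _ _ (fun j => ((((j.1.1.1.1 == q) && [&& sg2 j.1.1.1.2 == sg2 o,
    sg1 j.1.1.1.2 == sg1 o & om j.1.1.1.2 == om o]) && (j.1.1.2 == x1)) && (j.1.2 == x2))
    && (eta j.2 == eta y))); last by move=> j; rewrite /Z2; bool_ac.
  rewrite (@prob_joint_full (fun o' => [&& sg2 o' == sg2 o, sg1 o' == sg1 o & om o' == om o])
    _ (sg1 o) (sg2 o)); last by move=> o' /and3P[/eqP -> /eqP ->].
  rewrite /kap2 /=; congr (_ * _); ring.
- rewrite -(@prob_joint_y (fun a => (a.2 == x2) &&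
    ((a.1.2, sg1 a.1.1.2, om a.1.1.2, a.1.1.1) == (x1, sg1 o, om o, q)))); last first.
    by move=> a; rewrite !xpair_eqE => /andP[/eqP -> /andP[/andP[/andP[/eqP -> _] _] _]].
  by apply: eq_prob => j; bool_ac.
- rewrite (@eq_prob _ _ _ (fun j => ((j.1.1.1.1 == q) && ((sg1 j.1.1.1.2 == sg1 o) &&
    (om j.1.1.1.2 == om o))) && (j.1.1.2 == x1))); last by move=> j; bool_ac.
  rewrite (@prob_joint_x1 (fun a => (a.1 == q) && ((sg1 a.2 == sg1 o) && (om a.2 == om o)))
    q (sg1 o)); last by move=> a /and3P[/eqP -> /eqP ->].
  rewrite (prob_joint_q (fun o' => (sg1 o' == sg1 o) && (om o' == om o))).
  exact: Rmult_assoc.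
Qed.

Lemma informative3 :
  cond_entropy joint_law (fun j => (sg1 j.1.1.1.2, sg2 j.1.1.1.2))
    (fun j => (f (sg1 j.1.1.1.2), om j.1.1.1.2)) <
  cond_mutinfo joint_law (fun j => (j.1.1.2, j.1.2)) (fun j => eta j.2)
    (fun j => (f (sg1 j.1.1.1.2), om j.1.1.1.2, j.1.1.1.1)) ->
  informative joint_law Z3 K3 kap3.
Proof.
move=> lt; apply: (expect_ln_gt0 (kap := fun j => kap3 (Z3 j) (K3 j)) joint_law_pmf lt).
move=> [[[[q o] x1] x2] y] _ /=.
pose F o' := ((sg1 o', sg2 o') == (sg1 o, sg2 o)) && ((f (sg1 o'), om o') == (f (sg1 o), om o)).
(* The mutual information conditions on the centre in addition to the common part and the side
   information, which costs the factor [pQ q]. *)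
exists (prob (V x1 x2) (fun y' => eta y' == eta y)), (pQ q); split.
- rewrite (@eq_prob _ _ _ (fun j => ((((j.1.1.1.1 == q) && F j.1.1.1.2) && (j.1.1.2 == x1))
    && (j.1.2 == x2)) && (eta j.2 == eta y))); last by move=> j; rewrite /Z3 /F; bool_ac.
  rewrite (@prob_joint_full F _ (sg1 o) (sg2 o)); last first.
    by move=> o'; rewrite /F !xpair_eqE => /andP[/andP[/eqP -> /eqP ->]].
  rewrite /kap3 /=; congr (_ * _); ring.
- rewrite -(@prob_joint_y (fun a => ((a.1.2, a.2) == (x1, x2)) &&
    ((f (sg1 a.1.1.2), om a.1.1.2, a.1.1.1) == (f (sg1 o), om o, q)))); last first.
    by move=> a; rewrite !xpair_eqE => /andP[/andP[/eqP -> /eqP ->]].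
  by apply: eq_prob => j; bool_ac.
- rewrite -(prob_joint_q (fun o' => (f (sg1 o'), om o') == (f (sg1 o), om o))).
  by apply: eq_prob => j; bool_ac.
Qed.

(** The mutual information is not conditioned on the centre, yet [Z4] contains it: its weight [pQ]
    occurs in the joint probability and in [kap4], and cancels. *)
Lemma informative4 :
  cond_entropy joint_law (fun j => (sg1 j.1.1.1.2, sg2 j.1.1.1.2)) (fun j => om j.1.1.1.2) <
  cond_mutinfo joint_law (fun j => (j.1.1.2, j.1.2)) (fun j => eta j.2)
    (fun j => om j.1.1.1.2) ->
  informative joint_law Z4 K4 kap4.
Proof.
move=> lt; apply: (expect_ln_gt0 (kap := fun j => kap4 (Z4 j) (K4 j)) joint_law_pmf lt).
move=> [[[[q o] x1] x2] y] _ /=.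
pose F o' := ((sg1 o', sg2 o') == (sg1 o, sg2 o)) && (om o' == om o).
exists (prob (V x1 x2) (fun y' => eta y' == eta y)), 1; split.
- rewrite (@eq_prob _ _ _ (fun j => ((((j.1.1.1.1 == q) && F j.1.1.1.2) && (j.1.1.2 == x1))
    && (j.1.2 == x2)) && (eta j.2 == eta y))); last by move=> j; rewrite /Z4 /F; bool_ac.
  rewrite (@prob_joint_full F _ (sg1 o) (sg2 o)); last first.
    by move=> o'; rewrite /F !xpair_eqE => /andP[/andP[/eqP -> /eqP ->]].
  rewrite /kap4 /=; congr (_ * _); ring.
- rewrite -(@prob_joint_y (fun a => ((a.1.2, a.2) == (x1, x2)) && (om a.1.1.2 == om o))); last first.
    by move=> a; rewrite !xpair_eqE => /andP[/andP[/eqP -> /eqP ->]].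
  by apply: eq_prob => j; bool_ac.
- by rewrite Rmult_1_r.
Qed.

End Receiver.
End Coding.

Arguments kap1 {Q S1 S2 X1 X2} p1 {WT YT} z k.
Arguments kap2 {Q S1 S2 X1 X2} p2 {WT YT} z k.
Arguments kap3 {Q S1 S2 U X1 X2} p1 p2 {WT YT} z k.
Arguments kap4 {Q S1 S2 X1 X2} pQ p1 p2 {WT YT} z k.

(** * Block coding *)

Section Letterwise.
Variables (Om : finType) (n : nat).

Definition bmap (A B : finType) (h : A -> B) (s : {ffun 'I_n -> A}) : {ffun 'I_n -> B} :=
  [ffun i => h (s i)].

(** Only equality tests are compared, so that a tuple of blocks can stand for a block of tuples
    without identifying the two types. *)
Definition letterwise (An A : eqType) (Xn : {ffun 'I_n -> Om} -> An) (X : Om -> A) : Prop :=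
  forall h h', (Xn h == Xn h') = [forall i, X (h i) == X (h' i)].

Lemma letterwise_ffun (A : finType) (Xn : {ffun 'I_n -> Om} -> {ffun 'I_n -> A}) X :
  (forall h i, Xn h i = X (h i)) -> letterwise Xn X.
Proof.
move=> XnE h h'; apply/eqP/forallP => [e i|e]; first by rewrite -!XnE e.
by apply/ffunP => i; rewrite !XnE; apply/eqP.
Qed.

Lemma letterwise_pair (An A Bn B : eqType) (Xn : {ffun 'I_n -> Om} -> An) (X : Om -> A)
    (Yn : {ffun 'I_n -> Om} -> Bn) (Y : Om -> B) :
  letterwise Xn X -> letterwise Yn Y ->
  letterwise (fun h => (Xn h, Yn h)) (fun o => (X o, Y o)).
Proof.
move=> hX hY h h'; rewrite xpair_eqE hX hY; apply/andP/forallP => [[/forallP x /forallP y] i|xy].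
  by rewrite xpair_eqE x y.
by split; apply/forallP => i; have := xy i; rewrite xpair_eqE => /andP[].
Qed.

End Letterwise.

(** * Likelihood ratio tests on i.i.d. blocks *)

Section Iid.
Variables (Om ZT KT : finType) (P : Om -> R) (Z : Om -> ZT) (K : Om -> KT).
Variable kap : ZT -> KT -> R.
Hypotheses (P_pmf : is_pmf P) (P_info : informative P Z K kap).

Section Block.
Variables (n : nat) (Omn ZTn KTn : finType) (Pn : Omn -> R) (Zn : Omn -> ZTn) (Kn : Omn -> KTn).
Variables (kapn : ZTn -> KTn -> R) (phi : {ffun 'I_n -> Om} -> Omn).

(* [phi] identifies the n-fold power of [Om] with [Omn] in such a way that [Zn], [Kn] and [kapn]
   are the letterwise extensions of [Z], [K] and [kap]. *)
Definition block_of : Prop :=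
  [/\ bijective phi, forall h, Pn (phi h) = prodm (fun=> P) h,
      letterwise (fun h => Zn (phi h)) Z, letterwise (fun h => Kn (phi h)) K &
      forall h, kapn (Zn (phi h)) (Kn (phi h)) = \big[Rmult/1]_(i < n) kap (Z (h i)) (K (h i))].

(** At an outcome of positive probability each factor of the block test is a product over letters,
    so the test compares [L] with the product of the densities. *)
Lemma prob_fails_le L : block_of ->
  prob Pn (fun j => ~~ passes Pn Zn Kn kapn L (Zn j) (Kn j)) <=
  prob (prodm (fun _ : 'I_n => P))
    (fun h => ~~ Rleb L (\big[Rmult/1]_(i < n) density P Z K kap (h i))).
Proof.
move=> [phi_bij hP hZ hK hkap]; have [P0 _] := P_pmf; have [dens0 _] := P_info.
have probn (E : pred Omn) : prob Pn E = prob (prodm (fun=> P)) (fun h => E (phi h)).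
  rewrite /prob (reindex phi) /=; last exact: onW_bij.
  by apply: eq_bigr => h _; rewrite hP.
rewrite probn !probE; apply: expect_le => [h|h Ph]; first by apply: prod_ge0.
have Phi i : 0 < P (h i) by apply: (prodm_gt0 (mu := fun _ : 'I_n => P)).
case: (RlebP L) => [le|_] /=; last by case: (passes _ _ _ _ _ _ _) => /=; lra.
suff -> : passes Pn Zn Kn kapn L (Zn (phi h)) (Kn (phi h)) by right.
apply/RlebP; rewrite !probn hkap.
rewrite (@eq_prob _ _ _ (fun h' : {ffun 'I_n -> Om} => [forall i, K (h' i) == K (h i)])) //.
rewrite [X in _ <= X](@eq_prob _ _ _
  (fun h' : {ffun 'I_n -> Om} => [forall i, (Z (h' i) == Z (h i)) && (K (h' i) == K (h i))])); last first.
  move=> h'; rewrite hZ hK; apply/andP/forallP => [[/forallP hz /forallP hk] i|hzk].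
    by rewrite hz hk.
  by split; apply/forallP => i; have /andP[] := hzk i.
rewrite (prob_prodm _ (fun i o => K o == K (h i))).
rewrite (prob_prodm _ (fun i o => (Z o == Z (h i)) && (K o == K (h i)))).
rewrite Rmult_assoc -big_split /=.
set D := \big[Rmult/1]_(i < n) _; set N := \big[Rmult/1]_(i < n) _.
(* A negative or zero denominator would make the density negative or, by the convention for
   inverses, zero. *)
have D0 i : 0 < kap (Z (h i)) (K (h i)) * prob P (fun o => K o == K (h i)).
  have z0 : 0 < prob P (fun o => (Z o == Z (h i)) && (K o == K (h i))).
    by apply: (@prob_gt0 _ _ _ (h i)) => //; rewrite !eqxx.
  have := dens0 _ (Phi i); rewrite /density /Rdiv => pos.
  apply: Rnot_le_lt => le0.
  have [lt0|eq0] := Rle_lt_or_eq_dec _ _ le0.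
    have := Rinv_lt_0_compat _ lt0 => inv0; nra.
  by move: pos; rewrite eq0 Rinv_0; lra.
have -> : N = \big[Rmult/1]_(i < n) density P Z K kap (h i) * D.
  rewrite -big_split; apply: eq_bigr => i _ /=.
  by rewrite /density; field; split; move=> e; have := D0 i; rewrite e; lra.
by apply: Rmult_le_compat_r => //; apply: prod_ge0 => i _; left.
Qed.

End Block.

Lemma eventually_passes (Omn ZTn KTn : nat -> finType) (Pn : forall n, Omn n -> R)
    (Zn : forall n, Omn n -> ZTn n) (Kn : forall n, Omn n -> KTn n)
    (kapn : forall n, ZTn n -> KTn n -> R) (phi : forall n, {ffun 'I_n -> Om} -> Omn n) :
  (forall n, block_of (@Pn n) (@Zn n) (@Kn n) (@kapn n) (@phi n)) ->
  forall eps, 0 < eps -> exists N : nat, forall n, (N <= n)%N -> exists2 L, 0 < L &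
    prob (@Pn n) (fun j => ~~ passes (@Pn n) (@Zn n) (@Kn n) (@kapn n) L (Zn n j) (Kn n j))
      + / L < eps.
Proof.
move=> blk eps eps0; have [dens0 lnpos] := P_info.
have [N hN] := chernoff P_pmf dens0 lnpos eps0.
exists N => n /hN[L L0 lt]; exists L => //.
by apply: Rle_lt_trans lt; apply: Rplus_le_compat_r; exact: prob_fails_le (blk n).
Qed.

End Iid.

(** * Block codes as one-shot codes over alphabets of blocks *)

Section BlockCoding.
Variables (O Q S1 S2 U X1 X2 Y : finType).
Variables (pO : O -> R) (pQ : Q -> R) (p1 : Q -> S1 -> X1 -> R) (p2 : Q -> S2 -> X2 -> R).
Variables (V : X1 -> X2 -> Y -> R) (sg1 : O -> S1) (sg2 : O -> S2).
Variables (f : S1 -> U) (g : S2 -> U).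

Section Length.
Variable n : nat.

Definition blk (A B C : finType) (p : A -> B -> C -> R)
    (a : {ffun 'I_n -> A}) (b : {ffun 'I_n -> B}) : {ffun 'I_n -> C} -> R :=
  prodm (fun i => p (a i) (b i)).

Definition iid (A : finType) (p : A -> R) : {ffun 'I_n -> A} -> R := prodm (fun=> p).

Definition joint_block :=
  joint_law (iid pO) (iid pQ) (blk p1) (blk p2) (blk V) (bmap sg1) (bmap sg2).

(** The bijection that carries the i.i.d. law of single-letter outcomes to [joint_block]. *)
Definition unzip_block (h : {ffun 'I_n -> Q * O * X1 * X2 * Y}) :=
  (bmap (fun j => j.1.1.1.1) h, bmap (fun j => j.1.1.1.2) h, bmap (fun j => j.1.1.2) h,
   bmap (fun j => j.1.2) h, bmap (fun j => j.2) h).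

Lemma unzip_block_bij : bijective unzip_block.
Proof.
exists (fun t : {ffun 'I_n -> Q} * {ffun 'I_n -> O} * {ffun 'I_n -> X1} *
    {ffun 'I_n -> X2} * {ffun 'I_n -> Y} => [ffun i => (t.1.1.1.1 i, t.1.1.1.2 i, t.1.1.2 i, t.1.2 i, t.2 i)]).
  by move=> h; apply/ffunP => i; rewrite !ffunE; case: (h i) => [[[[? ?] ?] ?] ?].
move=> [[[[q o] x1] x2] y]; rewrite /unzip_block /=.
by do ![congr pair]; apply/ffunP => i; rewrite !ffunE.
Qed.

Lemma joint_blockE h : joint_block (unzip_block h) =
  prodm (fun=> joint_law pO pQ p1 p2 V sg1 sg2) h.
Proof.
rewrite /joint_block /joint_law /ext /iid /blk /prodm /= -!big_split /=.
by apply: eq_bigr => i _; rewrite !ffunE.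
Qed.

Variables (WT YT : finType) (om : O -> WT) (eta : Y -> YT).

Notation block_of := (block_of (joint_law pO pQ p1 p2 V sg1 sg2)).

Ltac letters := rewrite /Z1 /K1 /Z2 /K2 /Z3 /K3 /Z4 /K4 /=; repeat apply: letterwise_pair;
  apply: letterwise_ffun => h i; by rewrite !ffunE.

Lemma block1 : block_of (Z1 sg1) (K1 sg2 om eta) (kap1 p1) joint_block
  (Z1 (bmap sg1)) (K1 (bmap sg2) (bmap om) (bmap eta)) (kap1 (blk p1)) unzip_block.
Proof.
split; [exact: unzip_block_bij|exact: joint_blockE|letters|letters|move=> h].
by apply: eq_bigr => i _; rewrite !ffunE.
Qed.

Lemma block2 : block_of (Z2 sg2) (K2 sg1 om eta) (kap2 p2) joint_block
  (Z2 (bmap sg2)) (K2 (bmap sg1) (bmap om) (bmap eta)) (kap2 (blk p2)) unzip_block.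
Proof.
split; [exact: unzip_block_bij|exact: joint_blockE|letters|letters|move=> h].
by apply: eq_bigr => i _; rewrite !ffunE.
Qed.

Lemma block3 : block_of (Z3 sg1 sg2) (K3 sg1 f om eta) (kap3 p1 p2) joint_block
  (Z3 (bmap sg1) (bmap sg2)) (K3 (bmap sg1) (bmap f) (bmap om) (bmap eta))
  (kap3 (blk p1) (blk p2)) unzip_block.
Proof.
split; [exact: unzip_block_bij|exact: joint_blockE|letters|letters|move=> h].
by rewrite /kap3 /blk /prodm -big_split; apply: eq_bigr => i _ /=; rewrite !ffunE.
Qed.

Lemma block4 : block_of (Z4 sg1 sg2) (K4 om eta) (kap4 pQ p1 p2) joint_block
  (Z4 (bmap sg1) (bmap sg2)) (K4 (bmap om) (bmap eta))
  (kap4 (iid pQ) (blk p1) (blk p2)) unzip_block.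
Proof.
split; [exact: unzip_block_bij|exact: joint_blockE|letters|letters|move=> h].
by rewrite /kap4 /iid /blk /prodm -!big_split; apply: eq_bigr => i _ /=; rewrite !ffunE.
Qed.

End Length.

Hypotheses (pO_pmf : is_pmf pO) (pQ_pmf : is_pmf pQ).
Hypotheses (p1_pmf : forall q s, is_pmf (p1 q s)) (p2_pmf : forall q s, is_pmf (p2 q s)).
Hypothesis V_pmf : forall x1 x2, is_pmf (V x1 x2).
Hypothesis common : forall o, 0 < pO o -> f (sg1 o) = g (sg2 o).

Definition average_block n :=
  average (iid pO) (iid pQ) (blk p1) (blk p2) (blk V) (bmap sg1) (bmap sg2)
    (bmap (n := n) f) (bmap g).

Lemma iid_pmf n (A : finType) (p : A -> R) : is_pmf p -> is_pmf (iid (n := n) p).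
Proof. by move=> h; apply: prodm_pmf. Qed.

Lemma blk_pmf n (A B C : finType) (p : A -> B -> C -> R) (a : {ffun 'I_n -> A}) b :
  (forall a b, is_pmf (p a b)) -> is_pmf (blk p a b).
Proof. by move=> h; apply: prodm_pmf. Qed.

Section OneReceiver.
Variables (WT YT : finType) (om : O -> WT) (eta : Y -> YT).
Notation J := (joint_law pO pQ p1 p2 V sg1 sg2).

Hypothesis conds : receiver_conds J (fun j => j.1.1.1.1) (fun j => sg1 j.1.1.1.2)
  (fun j => sg2 j.1.1.1.2) (fun j => f (sg1 j.1.1.1.2)) (fun j => om j.1.1.1.2)
  (fun j => j.1.1.2) (fun j => j.1.2) (fun j => eta j.2).

(** Each test is granted [eps / 4]. The decoder takes the code as an argument and the code law is
    the same for both receivers, so the two bounds can be combined. *)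
Lemma average_block_error eps : 0 < eps -> exists N, forall n, (N <= n)%N ->
  exists dec, average_block (n := n) (fun o c y =>
    indic (dec c (bmap eta y, bmap om o) != (bmap sg1 o, bmap sg2 o))) < eps.
Proof.
move=> eps0; have [c1 c2 c3 c4] := conds; have e4 : 0 < eps / 4 by lra.
have J_pmf : is_pmf J by exact: joint_law_pmf.
have [N1 h1] := eventually_passes J_pmf
  (informative1 pO_pmf pQ_pmf p1_pmf p2_pmf V_pmf c1) (fun n => block1 n om eta) e4.
have [N2 h2] := eventually_passes J_pmf
  (informative2 pO_pmf pQ_pmf p1_pmf p2_pmf V_pmf c2) (fun n => block2 n om eta) e4.
have [N3 h3] := eventually_passes J_pmf
  (informative3 pO_pmf pQ_pmf p1_pmf p2_pmf V_pmf c3) (fun n => block3 n om eta) e4.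
have [N4 h4] := eventually_passes J_pmf
  (informative4 pO_pmf pQ_pmf p1_pmf p2_pmf V_pmf c4) (fun n => block4 n om eta) e4.
exists (maxn (maxn N1 N2) (maxn N3 N4)) => n.
rewrite !geq_max => /andP[/andP[/h1[L1 L10 l1] /h2[L2 L20 l2]] /andP[/h3[L3 L30 l3] /h4[L4 L40 l4]]].
(* [O] is inhabited since [pO] has total mass 1; the point supplies the default output [s0]. *)
have [o0 _] : exists o : O, 0 < 2.
  have [_ p] := pO_pmf; case: (pickP (@predT O)) => [o _|none]; first by exists o; lra.
  by move: p; rewrite /rsum big_pred0 // => ?; lra.
pose s0 : {ffun 'I_n -> S1} * {ffun 'I_n -> S2} := ([ffun=> sg1 o0], [ffun=> sg2 o0]).
exists (decode (iid pO) (iid pQ) (blk p1) (blk p2) (blk V) (bmap sg1) (bmap sg2)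
    (bmap f) (bmap g) (bmap om) (bmap eta) L1 L2 L3 L4 s0).
apply: Rle_lt_trans.
  apply: average_decode_error => //.
  - exact: iid_pmf.
  - exact: iid_pmf.
  - by move=> q s; exact: blk_pmf.
  - by move=> q s; exact: blk_pmf.
  - by move=> q s; exact: blk_pmf.
  - move=> o oP; apply/ffunP => i; rewrite !ffunE; apply: common.
    by apply: (prodm_gt0 (mu := fun _ : 'I_n => pO)) oP _ => _; case: pO_pmf.
move: l1 l2 l3 l4; rewrite /joint_block; lra.
Qed.

End OneReceiver.
End BlockCoding.

(** * Both receivers under one random code, and the choice of a deterministic code *)

Unset Implicit Arguments.

Theorem theorem4 (S1 S2 W1 W2 X1 X2 Y1 Y2 : finType)
    (pS : src S1 S2 W1 W2 -> R) (W : X1 -> X2 -> (Y1 * Y2)%type -> R)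
    (HpS : is_pmf pS) (HW : forall x1 x2, is_pmf (W x1 x2))
    (TU : finType) (fU : S1 -> TU) (gU : S2 -> TU)
    (HU : is_GK_common pS fU gU) :
  (exists (Q : finType) (pQ : Q -> R)
          (p1 : Q -> S1 -> X1 -> R) (p2 : Q -> S2 -> X2 -> R),
     is_pmf pQ /\ (forall q s1, is_pmf (p1 q s1)) /\ (forall q s2, is_pmf (p2 q s2)) /\
     let P := joint pQ pS p1 p2 W in
     receiver_conds P (@rvQ S1 S2 W1 W2 X1 X2 Y1 Y2 Q) (@rvS1 _ _ _ _ _ _ _ _ Q)
       (@rvS2 _ _ _ _ _ _ _ _ Q) (fun o => fU (@rvS1 _ _ _ _ _ _ _ _ Q o))
       (@rvW1 _ _ _ _ _ _ _ _ Q) (@rvX1 _ _ _ _ _ _ _ _ Q) (@rvX2 _ _ _ _ _ _ _ _ Q)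
       (@rvY1 _ _ _ _ _ _ _ _ Q) /\
     receiver_conds P (@rvQ S1 S2 W1 W2 X1 X2 Y1 Y2 Q) (@rvS1 _ _ _ _ _ _ _ _ Q)
       (@rvS2 _ _ _ _ _ _ _ _ Q) (fun o => fU (@rvS1 _ _ _ _ _ _ _ _ Q o))
       (@rvW2 _ _ _ _ _ _ _ _ Q) (@rvX1 _ _ _ _ _ _ _ _ Q) (@rvX2 _ _ _ _ _ _ _ _ Q)
       (@rvY2 _ _ _ _ _ _ _ _ Q)) ->
  achievable pS W 1.
Proof.
move=> [Q [pQ [p1 [p2 [pQ_pmf [p1_pmf [p2_pmf /= [c1 c2]]]]]]]] eps eps0.
pose sg1 (s : src S1 S2 W1 W2) := s.1.1.1; pose sg2 (s : src S1 S2 W1 W2) := s.1.1.2.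
pose om1 (s : src S1 S2 W1 W2) := s.1.2; pose om2 (s : src S1 S2 W1 W2) := s.2.
pose eta1 (y : Y1 * Y2) := y.1; pose eta2 (y : Y1 * Y2) := y.2.
have jointE : joint pQ pS p1 p2 W = joint_law pS pQ p1 p2 W sg1 sg2.
  by apply: functional_extensionality => -[[[[q s] x1] x2] y].
rewrite jointE in c1 c2.
have common s : 0 < pS s -> fU (sg1 s) = gU (sg2 s).
  by move: s => [[[s1 s2] w1] w2]; case: HU => /(_ s1 s2 w1 w2).
have e2 : 0 < eps / 2 by lra.
have [N1 h1] := average_block_error (om := om1) (eta := eta1) HpS pQ_pmf p1_pmf p2_pmf HW common c1 e2.
have [N2 h2] := average_block_error (om := om2) (eta := eta2) HpS pQ_pmf p1_pmf p2_pmf HW common c2 e2.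
(* The successor makes the block length positive. *)
pose n := (maxn N1 N2).+1.
have [dec1 lt1] := h1 n (leq_trans (leq_maxl _ _) (leqnSn _)).
have [dec2 lt2] := h2 n (leq_trans (leq_maxr _ _) (leqnSn _)).
have lt : average_block pS pQ p1 p2 W sg1 sg2 fU gU (fun o c y =>
    indic (dec1 c (bmap eta1 y, bmap om1 o) != (bmap sg1 o, bmap sg2 o)) +
    indic (dec2 c (bmap eta2 y, bmap om2 o) != (bmap sg1 o, bmap sg2 o))) < eps.
  rewrite /average_block averageD; move: lt1 lt2; rewrite /average_block; lra.
(* With the average over codes outermost, some fixed code keeps the summed error of both receivers
   below [eps]. *)
move: lt; rewrite /average_block /average expect_swap.
have code_pmf : is_pmf (code_law (iid pQ) (blk p1) (blk p2) (bmap (n := n) fU) (bmap gU)).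
  by apply: code_law_pmf => [|q s|q s]; [exact: iid_pmf|exact: blk_pmf|exact: blk_pmf].
move=> /(expect_lt_ex code_pmf)[c ltc].
exists n, n; do 2 split=> //; split.
  by apply: Rdiv_diag; apply: not_0_INR.
exists (fun s => c.1.2 s), (fun s => c.2 s), (dec1 c), (dec2 c).
apply: Rle_lt_trans ltc; rewrite /error_prob; apply: sum_le => s _ /=.
apply: Rmult_le_compat_l; first by apply: prod_ge0 => i _; case: HpS.
rewrite big_mkcond; apply: sum_le => y _.
have W0 : 0 <= blk W (c.1.2 (bmap sg1 s)) (c.2 (bmap sg2 s)) y.
  by apply: prod_ge0 => i _; case: (HW (c.1.2 (bmap sg1 s) i) (c.2 (bmap sg2 s) i)).
(* The error event is a union over the receivers; its indicator is bounded by the sum of the two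
   indicators. *)
apply: (Rle_trans _ (blk W (c.1.2 (bmap sg1 s)) (c.2 (bmap sg2 s)) y *
  indic ((dec1 c (bmap eta1 y, bmap om1 s) != (bmap sg1 s, bmap sg2 s)) ||
         (dec2 c (bmap eta2 y, bmap om2 s) != (bmap sg1 s, bmap sg2 s))))).
  rewrite -[X in X || _]/(dec1 c (bmap eta1 y, bmap om1 s) != (bmap sg1 s, bmap sg2 s)).
  rewrite -[X in _ || X]/(dec2 c (bmap eta2 y, bmap om2 s) != (bmap sg1 s, bmap sg2 s)).
  case: (_ || _) => /=; last by rewrite Rmult_0_r; right.
  by rewrite Rmult_1_r; right.
by apply: Rmult_le_compat_l => //; exact: indicU.
Qed.
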